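(* Suppose that: (G) for each $t\in\mathbb N$, $\xi_t\sim\mathcal N(0,Q)$; (Q) $\overline{\mathrm{Im}(Q)}=\mathcal H$ (equivalently $\mathrm{Ker}(Q)=\{0\}$); (M1) there is a (measurable) map $m_0:\mathcal H\to\mathcal H$ with $\Psi_0=Q\circ m_0$; (M2) there are constants $c_1,c_2>0$ with $c_1\|Q\|_{\mathcal L}<1$ and $\|m_0(x)\|_{\mathcal H}\le c_1\|x\|_{\mathcal H}+c_2$ for all $x\in\mathcal H$. Then the Markov chain $\{X_t\}_{t\in\mathbb N}$ admits a unique invariant probability distribution $\pi$, and there exist constants $\gamma\in(0,1)$ and $C>0$ such that for all $t\in\mathbb N$ and all $x\in\mathcal H$, $$\sup_{\phi\in\mathcal C_b(\mathcal H),\ \|\phi\|_{\mathcal C_b}\le 1}\Big|(\mathcal P^t\phi)(x)-\int_{\mathcal H}\phi(z)\,\pi(dz)\Big|\le C\gamma^t\,(1+\|x\|_{\mathcal H}).$$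
   Context: Let $d\ge1$, $D=[0,1]^d$ and $\mathcal H=L^2(D)$ (real-valued, Lebesgue measure), with inner product $\langle\cdot,\cdot\rangle_{\mathcal H}$ and norm $\|\cdot\|_{\mathcal H}$. $\|\cdot\|_{\mathcal L}$ denotes the operator norm of a bounded linear operator on $\mathcal H$. On a filtered probability space $(\Omega,\mathcal I,\{\mathcal F_t\},\mathbb P)$ consider the nonlinear functional autoregressive (NFAR) model $X_{t+1}=\Psi_0(X_t)+\xi_t$, $t\in\mathbb N$, where $\Psi_0:\mathcal H\to\mathcal H$ is a measurable (possibly nonlinear) operator, $(X_t)$ is $\{\mathcal F_t\}$-adapted, and $\{\xi_t\}$ are i.i.d. mean-zero $\mathcal H$-valued random elements with $\xi_t$ $\mathcal F_{t+1}$-measurable and independent of $\mathcal F_t$. The covariance kernel is $k(u,v)=\mathbb E[\xi_1(u)\xi_1(v)]$ with $\int_D k(u,u)\,du<\infty$, and $Q$ is the covariance operator $(Qf)(u)=\int_D k(u,v)f(v)\,dv$ (self-adjoint, nonnegative, trace class). $\mathcal N(\mu,Q)$ denotes the Gaussian measure on $\mathcal H$ with mean $\mu$ and covariance operator $Q$. $\mathcal C_b(\mathcal H)$ is the space of bounded measurable $\phi:\mathcal H\to\mathbb R$ with $\|\phi\|_{\mathcal C_b}=\sup_x|\phi(x)|$. For $t\in\mathbb N$, $\mathcal P^t(x,A)=\mathbb P(X_{t+1}\in A\mid X_1=x)$ and $(\mathcal P^t\phi)(x)=\int\phi(z)\mathcal P^t(x,dz)$. *)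

(* Defs.v *)
From mathcomp Require Import all_boot all_order all_algebra.
From mathcomp Require Export all_classical all_reals all_analysis.
Export numFieldNormedType.Exports.

Set Implicit Arguments.
Unset Strict Implicit.
Unset Printing Implicit Defensive.
Import Order.TTheory GRing.Theory Num.Theory.
Local Open Scope classical_set_scope.
Local Open Scope ring_scope.

Notation BorelT H := (g_sigma_algebraType (@open H)).

Section Defs.
Context {R : realType}.

Definition unit_cube (d : nat) : set (d.-tuple R) :=
  [set x | forall i : 'I_d, 0 <= tnth x i <= 1].



(* lam is Lebesgue measure on D (extended by 0 outside D):
   it is null outside D and gives every box [a,b] inside D its volume.
   These properties determine lam uniquely on the Borel sets of R^d. *)
Definition lebesgue_on_unit_cube (d : nat)
    (lam : {measure set (d.-tuple R) -> \bar R}) : Prop :=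
  lam (~` (@unit_cube d)) = 0%E /\
  forall a b : d.-tuple R,
    (forall i : 'I_d, 0 <= tnth a i /\ tnth a i <= tnth b i /\ tnth b i <= 1) ->
    lam [set x | forall i : 'I_d, tnth a i <= tnth x i <= tnth b i]
      = (\prod_(i < d) (tnth b i - tnth a i))%:E.

(* (H, U) is (a copy of) the real Hilbert space L^2(D, lam):
   U sends each x : H to a square-integrable representative, U is linear
   modulo a.e. equality, a.e.-injective, onto L^2, and the norm of H is
   the L^2 norm. *)
Definition L2_model (d : nat) (lam : {measure set (d.-tuple R) -> \bar R})
    (H : normedModType R) (U : H -> d.-tuple R -> R) : Prop :=
  [/\ forall x, U x \in Lfun lam 2%:E,
      forall (a : R) (x y : H),
        U (a *: x + y) = (fun u => a * U x u + U y u) %[ae lam],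
      forall x y : H, U x = U y %[ae lam] -> x = y,
      forall f : d.-tuple R -> R, f \in Lfun lam 2%:E ->
        exists x : H, U x = f %[ae lam]
    & forall x : H, `|x| ^+ 2 = Rintegral lam setT (fun u => U x u ^+ 2)].

Definition L2_inner (d : nat) (lam : {measure set (d.-tuple R) -> \bar R})
    (H : normedModType R) (U : H -> d.-tuple R -> R) (x y : H) : R :=
  Rintegral lam setT (fun u => U x u * U y u).

Definition op_norm (H : normedModType R) (Q : H -> H) : R :=
  sup [set `|Q x| | x in [set x : H | `|x| <= 1]].

Definition borel_map (H : normedModType R) (f : H -> H) : Prop :=
  forall B : set H, <<s @open H >> B -> <<s @open H >> (f @^-1` B).

Section Prob.
Context {dO : measure_display} {Omega : measurableType dO}.
Variable P : probability Omega R.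

Definition meas_wrt (H : normedModType R) (G : set (set Omega))
    (X : Omega -> H) : Prop :=
  forall B : set H, <<s @open H >> B -> G (X @^-1` B).

Definition is_filtration (F : nat -> set (set Omega)) : Prop :=
  forall t, [/\ sigma_algebra setT (F t), F t `<=` measurable & F t `<=` F t.+1].

Definition indep_of (H : normedModType R) (G : set (set Omega))
    (Y : Omega -> H) : Prop :=
  forall A B, G A -> <<s @open H >> B ->
    P (A `&` Y @^-1` B) = (P A * P (Y @^-1` B))%E.

(* Y ~ N(0, Q) (Gaussian measure on H with mean 0 and covariance Q),
   via the characteristic functional:
   E[exp(i <h,Y>)] = exp(-<Qh,h>/2) for every h in H. *)
Definition gaussian0 (H : normedModType R) (inner : H -> H -> R)
    (Q : H -> H) (Y : Omega -> H) : Prop :=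
  forall h : H,
    Rintegral P setT (fun w => cos (inner h (Y w))) = expR (- (inner (Q h) h / 2))
    /\ Rintegral P setT (fun w => sin (inner h (Y w))) = 0.

(* One-step transition operator of X_{t+1} = Psi(X_t) + xi_t
   (xi identically distributed, represented by xi1):
   (P phi)(x) = E[ phi(Psi x + xi_1) ]. *)
Definition step_op (H : normedModType R) (Psi : H -> H) (xi1 : Omega -> H)
    (phi : H -> R) : H -> R :=
  fun x => Rintegral P setT (fun w => phi (Psi x + xi1 w)).

Definition trans_op (H : normedModType R) (Psi : H -> H) (xi1 : Omega -> H)
    (t : nat) (phi : H -> R) : H -> R :=
  iter t (step_op Psi xi1) phi.

Definition step_kernel (H : normedModType R) (Psi : H -> H) (xi1 : Omega -> H)
    (x : H) (B : set H) : \bar R :=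
  P [set w | B (Psi x + xi1 w)].

Definition invariant_prob (H : normedModType R) (Psi : H -> H)
    (xi1 : Omega -> H) (pi : probability (BorelT H) R) : Prop :=
  forall B : set (BorelT H), measurable B ->
    pi B = (\int[pi]_x step_kernel Psi xi1 x B)%E.

End Prob.
End Defs.

(* Main.v *)
From HB Require Import structures.
Require Import Defs.
From mathcomp Require Import all_boot all_order all_algebra.
From mathcomp Require Import all_classical all_reals all_analysis.
From mathcomp Require Import measurable_realfun ring lra.
Import numFieldNormedType.Exports.
Import Order.TTheory GRing.Theory Num.Theory.
Local Open Scope classical_set_scope.
Local Open Scope ring_scope.

Set Implicit Arguments.
Unset Strict Implicit.
Unset Printing Implicit Defensive.

(**
  The law of X_1 given X_0 = x is that of Q h + xi with h = m0 x.  Splitting off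
  the component <h, xi>, the variable xi has the law of Y + z v, where z is an
  independent standard Gaussian on the line and Q h = r v, r^2 = <Q h, h>; hence
  the total variation distance of the laws of xi and Q h + xi is at most that of
  two standard Gaussians on the line shifted by r.  It is therefore bounded away
  from its maximum for x in a ball, and small for small h, so that the chain
  satisfies a local overlap (small set) condition and maps bounded measurable
  functions to measurable ones.  Since |E X_1| grows at the rate c1 ||Q|| < 1, the
  norm is a Lyapunov function, and Harris' theorem in the functional form of
  Hairer and Mattingly applies.

  The equality of laws is checked on characteristic functionals.  For this one
  needs that the Borel sets are generated by the half-spaces, i.e. that the space
  is separable; this follows from the finite trace and the dense range of Q.
*)

(** The factorisation [Psi0 = Q \o m0] enters through one number: a translation by [Q k] is paid for
    by [<Q k, k> <= ||Q|| |k|^2]. A shift outside the range of the square root of [Q] would make the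
    two Gaussian laws mutually singular and leave no overlap at all. The same estimate makes the
    one-step mean continuous in [h = m0 x], so that composing it with the merely measurable [m0]
    stays measurable. Harris' theorem is run on functions instead of measures: the iterates of a
    test function are Cauchy at a base point, and their limit, as a functional of the test function,
    defines the invariant law. Countable additivity then has to be proved; it rests on the rate
    being uniform over [|phi| <= 1]. Equality of laws is reached without an inversion formula. The
    functions on which two laws agree contain the cosines and are stable under linear combinations
    and bounded limits; products, signs and finally indicators of Borel sets are recovered inside
    the class generated in this way. *)

Section BoundedIntegral.
Context {R : realType} {d : measure_display} {T : measurableType d}.
Variable P : probability T R.

Lemma bounded_integrable (f : T -> R) (M : R) :
  measurable_fun setT f -> (forall x, `|f x| <= M) ->
  P.-integrable setT (EFin \o f).
Proof.
move=> mf fM; apply: measurable_bounded_integrable => //.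
  by apply: (le_lt_trans (probability_le1 P measurableT)); rewrite ltry.
exists M; split; first exact: num_real.
by move=> N MN x _; exact: le_trans (fM x) (ltW MN).
Qed.

Lemma Rintegral_prob_cst (c : R) : \int[P]_x c = c.
Proof. by rewrite Rintegral_cst// [X in fine X](@probability_setT _ _ _ P) mulr1. Qed.

Lemma le_prob_Rintegral (f : T -> R) (M : R) :
  P.-integrable setT (EFin \o f) -> (forall x, f x <= M) ->
  \int[P]_x f x <= M.
Proof.
move=> intf fM; rewrite -[leRHS]Rintegral_prob_cst; apply: le_Rintegral => //.
by apply: (@bounded_integrable (fun=> M) `|M|).
Qed.

Lemma norm_prob_Rintegral (f : T -> R) (M : R) :
  measurable_fun setT f -> (forall x, `|f x| <= M) -> `|\int[P]_x f x| <= M.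
Proof.
move=> mf fM; have intf := bounded_integrable mf fM.
apply: le_trans (le_normr_Rintegral measurableT intf) _.
apply: le_prob_Rintegral => //; apply: (@bounded_integrable _ M).
  exact: measurableT_comp.
by move=> x; rewrite normr_id.
Qed.

Lemma bounded_Rintegral_cvg (f_ : nat -> T -> R) (f : T -> R) (M : R) :
  (forall n, measurable_fun setT (f_ n)) -> (forall n x, `|f_ n x| <= M) ->
  (forall x, f_ n x @[n --> \oo] --> f x) ->
  \int[P]_x f_ n x @[n --> \oo] --> \int[P]_x f x.
Proof.
move=> mf_ f_M f_f.
have mf : measurable_fun setT f.
  by apply: measurable_fun_cvg => // x _; exact: f_f.
have fM x : `|f x| <= M.
  have : `|f_ n x| @[n --> \oo] --> `|f x| by apply: cvg_norm; exact: f_f.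
  move=> /cvg_lim <- //; apply: limr_le; first by apply: is_cvg_norm; apply/cvg_ex; exists (f x); exact: f_f.
  by apply: nearW => n; exact: f_M.
apply: fine_cvg; rewrite fineK; last first.
  exact: integrable_fin_num (bounded_integrable mf fM).
apply: (@dominated_cvg _ _ _ _ _ measurableT _ _ (cst M%:E)) => //.
- by move=> n; apply/measurable_EFinP.
- by move=> x _; apply: cvg_EFin; [exact: nearW|exact: f_f].
- by apply: (@bounded_integrable (cst M) `|M|).
- by move=> n x _; rewrite lee_fin.
Qed.

End BoundedIntegral.

(** * The standard Gaussian measure on the line *)

Section StandardGaussian.
Context {R : realType}.
Local Notation mu := (@lebesgue_measure R).

Let gauss (x : R) := expR (- x ^+ 2 / 2).

Lemma normal_pdf01E (x : R) : normal_pdf 0 1 x = normal_peak 1 * gauss x.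
Proof.
by rewrite normal_pdfE ?oner_neq0// /normal_fun subr0 expr1n.
Qed.

Lemma is_derive_gauss (x : R) : is_derive x 1 gauss (- x * gauss x).
Proof.
have h : is_derive x 1 (fun y : R => - y ^+ 2 / 2) (- x).
  have -> : (fun y : R => - y ^+ 2 / 2) = (fun y : R => (- 2^-1) *: y ^+ 2).
    by apply/funext => y; rewrite /GRing.scale/=; field.
  by apply: is_derive_eq; rewrite /GRing.scale/=; field.
have := @is_derive1_comp _ expR _ x _ _ (is_derive_expR _) h.
by rewrite mulrC.
Qed.

Lemma is_derive_cos_affine (a b x : R) :
  is_derive x 1 (fun y => cos (a * y + b)) (- a * sin (a * x + b)).
Proof.
have h : is_derive x 1 (fun y : R => a * y + b) a.
  by apply: is_derive_eq; rewrite /GRing.scale/=; ring.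
have := @is_derive1_comp _ cos _ x _ _ (is_derive_cos _) h.
by rewrite mulrC mulrN mulNr.
Qed.

Lemma is_derive_sin_affine (a b x : R) :
  is_derive x 1 (fun y => sin (a * y + b)) (a * cos (a * x + b)).
Proof.
have h : is_derive x 1 (fun y : R => a * y + b) a.
  by apply: is_derive_eq; rewrite /GRing.scale/=; ring.
have := @is_derive1_comp _ sin _ x _ _ (is_derive_sin _) h.
by rewrite mulrC.
Qed.

Lemma Rintegral_normal_prob (f : R -> R) (M : R) :
  measurable_fun setT f -> (forall x, `|f x| <= M) ->
  \int[normal_prob (0:R) 1]_x f x = \int[mu]_x (f x * normal_pdf 0 1 x).
Proof.
move=> mf fM; congr fine.
have intf := @bounded_integrable _ _ _ (normal_prob (0:R) 1) _ _ mf fM.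
rewrite -(Radon_Nikodym_change_of_variables (normal_prob_dominates 0 1))//=.
apply: ae_eq_integral => //.
- apply: emeasurable_funM; first exact/measurable_EFinP.
  apply: (measurable_int mu).
  by apply: Radon_Nikodym_integrable; exact: normal_prob_dominates.
- apply/measurable_EFinP; apply: measurable_funM => //.
  exact: measurable_normal_pdf.
- under [X in ae_eq _ _ _ X]eq_fun do rewrite EFinM.
  apply: ae_eqe_mul2l => /=.
  rewrite Radon_NikodymE//=; first exact: normal_prob_dominates.
  move=> dom; case: cid => /= h [h1 h2 h3].
  apply: integral_ae_eq => //=.
  + by apply/measurable_EFinP; exact: measurable_normal_pdf.
  + by move=> E _ mE; rewrite -h3.
Qed.

Let shift_mfun (s : R) : measurableTypeR R -> measurableTypeR R :=
  fun x => x + s.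

Let measurable_shift (s : R) : measurable_fun setT (shift_mfun s).
Proof.
have : measurable_fun setT (fun x : R => x + s) by exact: measurable_funD.
by [].
Qed.

HB.instance Definition _ (s : R) :=
  isMeasurableFun.Build _ _ _ _ (shift_mfun s) (measurable_shift s).

Lemma lebesgue_measure_shift (s : R) (A : set R) : measurable A ->
  pushforward mu (shift_mfun s) A = mu A.
Proof.
move=> mA; apply/esym/lebesgue_measure_unique => //= _ [[a b]] _ <-.
rewrite /pushforward/=.
have -> : (fun x => x + s) @^-1` `]a, b] = `]a - s, b - s]%classic.
  by apply/seteqP; split => x /=; rewrite !in_itv/= ltrBlDr lerBrDr.
rewrite !lebesgue_measure_itv/= !lte_fin ltrD2r.
by case: ifP => // _; congr (_%:E); ring.
Qed.

Lemma lebesgue_shift (s : R) (f : R -> R) :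
  measurable_fun setT f -> mu.-integrable setT (fun x => (f (x + s))%:E) ->
  mu.-integrable setT (EFin \o f) /\ \int[mu]_x f (x + s) = \int[mu]_x f x.
Proof.
move=> mf intf.
have mf' : measurable_fun setT (EFin \o f) by apply/measurable_EFinP.
have ms := measurable_shift s.
split; last first.
  congr fine.
  rewrite -(@integral_pushforward _ _ _ _ _ _ ms mu setT _ mf' intf)//.
  by apply: eq_measure_integral => //= A mA _; exact: lebesgue_measure_shift.
have := @integrable_pushforward _ _ _ _ _ _ ms mu setT _ mf' intf measurableT.
move=> /integrableP[_ h]; apply/integrableP; split => //.
apply: le_lt_trans h; rewrite le_eqVlt; apply/orP; left; apply/eqP.
by apply: eq_measure_integral => //= A mA _; apply/esym/lebesgue_measure_shift.
Qed.

Local Notation pdf := (@normal_pdf R 0 1).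

Lemma measurable_pdf01 : measurable_fun setT pdf.
Proof. exact: measurable_normal_pdf. Qed.

Lemma Rintegral_pdf01 : \int[mu]_x pdf x = 1.
Proof. by rewrite /Rintegral integral_normal_pdf. Qed.

Lemma normal_pdf_shift (s x : R) :
  pdf (x - s) = pdf x * expR (s * x - s ^+ 2 / 2).
Proof.
by rewrite !normal_pdf01E /gauss -mulrA -expRD; congr (_ * expR _); field.
Qed.

Lemma shifted_pdf_integrable (s : R) :
  mu.-integrable setT (EFin \o (fun x => pdf (x - s))) /\
  \int[mu]_x pdf (x - s) = 1.
Proof.
have m : measurable_fun setT (fun x : R => pdf (x - s)).
  apply: measurableT_comp; first exact: measurable_pdf01.
  exact: measurable_funB.
have := @lebesgue_shift s (fun x => pdf (x - s)) m.
under eq_fun do rewrite addrK.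
move=> /(_ (integrable_normal_pdf 0 1))[? <-]; split => //.
by under eq_Rintegral do rewrite addrK; exact: Rintegral_pdf01.
Qed.

(** The bound [|x| <= exp x + exp (- x)] reduces the moment to exponential tilts of the density, and
    a tilted density is a multiple of a shifted one. *)
Lemma affine_moment_integrable (a : R) :
  mu.-integrable setT (EFin \o (fun x => (a + `|x|) * pdf x)).
Proof.
have ie (s : R) : mu.-integrable setT (EFin \o (fun x => expR (s * x) * pdf x)).
  have [i _] := shifted_pdf_integrable s.
  have := integrableZl measurableT (expR (s ^+ 2 / 2)) i.
  apply: eq_integrable => // x _ /=; rewrite -EFinM normal_pdf_shift.
  by congr (_%:E); rewrite expRB; field; rewrite gt_eqF// expR_gt0.
have im : mu.-integrable setT (EFin \o (fun x => `|a| * pdf x)).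
  by have := integrableZl measurableT `|a| (integrable_normal_pdf 0 1).
have := integrableD measurableT (integrableD measurableT (ie 1) (ie (- 1))) im.
apply: le_integrable => //.
  apply/measurable_EFinP; apply: measurable_funM; last exact: measurable_pdf01.
  by apply: measurable_funD => //; exact: measurableT_comp.
move=> x _ /=; rewrite lee_fin -!mulrDl.
rewrite !normrM; apply: ler_wpM2r => //.
rewrite (le_trans (ler_normD _ _))// normr_id addrC ger0_norm; last first.
  by rewrite !addr_ge0// expR_ge0.
rewrite lerD2r mul1r mulN1r; have := expR_ge1Dx x; have := expR_ge1Dx (- x).
have := expR_gt0 x; have := expR_gt0 (- x).
by case: (lerP 0 x) => h; [rewrite ger0_norm//; lra|rewrite ltr0_norm//; lra].
Qed.

Definition gauss_abs_moment : R := \int[mu]_x (`|x| * pdf x).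

Lemma gauss_abs_moment_ge0 : 0 <= gauss_abs_moment.
Proof. by apply: Rintegral_ge0 => x _; rewrite mulr_ge0// normal_pdf_ge0. Qed.

(* The overlap of the densities [f (x - s)] and [f x] is at least
   [exp (- |s| |x| - s^2 / 2) f x], which is bounded below by the tangent line
   of [exp] at [- kappa |s|], [kappa] being the first absolute moment. *)
Lemma gaussian_shift_overlap (psi : R -> R) (s : R) :
  measurable_fun setT psi -> (forall x, `|psi x| <= 1) ->
  `|\int[normal_prob (0:R) 1]_x psi (x + s) - \int[normal_prob (0:R) 1]_x psi x|
    <= 2 * (1 - expR (- (gauss_abs_moment * `|s| + s ^+ 2 / 2))).
Proof.
move=> mpsi psi1; set c := expR _.
have mpsis : measurable_fun setT (fun x : R => psi (x + s)).
  by apply: measurableT_comp => //; exact: measurable_funD.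
rewrite (Rintegral_normal_prob mpsi psi1).
rewrite (Rintegral_normal_prob mpsis (fun x => psi1 (x + s))).
have [is1 is2] := shifted_pdf_integrable s.
have ipdf := @integrable_normal_pdf R 0 1.
have ipsi (h : R -> R) : mu.-integrable setT (EFin \o h) ->
    mu.-integrable setT (EFin \o (fun x => psi x * h x)).
  move=> ih; apply: (le_integrable measurableT _ _ ih).
    apply/measurable_EFinP; apply: measurable_funM => //.
    by apply/measurable_EFinP; exact: (measurable_int mu ih).
  by move=> x _; rewrite /= lee_fin normrM ler_piMl.
have -> : \int[mu]_x (psi (x + s) * pdf x) = \int[mu]_x (psi x * pdf (x - s)).
  have m : measurable_fun setT (fun x : R => psi x * pdf (x - s)).
    by apply/measurable_EFinP; exact: (measurable_int mu (ipsi _ is1)).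
  have := @lebesgue_shift s (fun x => psi x * pdf (x - s)) m.
  under [X in _.-integrable _ X]eq_fun do rewrite addrK.
  have ips : mu.-integrable setT (fun x => (psi (x + s) * pdf x)%:E).
    apply: (le_integrable measurableT _ _ ipdf).
      apply/measurable_EFinP; apply: measurable_funM => //.
      exact: measurable_pdf01.
    by move=> x _; rewrite /= lee_fin normrM ler_piMl.
  by move=> /(_ ips)[_ <-]; apply: eq_Rintegral => x _; rewrite addrK.
rewrite -RintegralB//; [|exact: ipsi|exact: (ipsi _ ipdf)].
have iB : mu.-integrable setT (EFin \o (fun x => psi x * pdf (x - s) - psi x * pdf x)).
  have := integrableB measurableT (ipsi _ is1) (ipsi _ ipdf).
  by apply: eq_integrable.
apply: le_trans (le_normr_Rintegral measurableT iB) _.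
have iT : mu.-integrable setT (EFin \o (fun x => `|s| * (`|x| * pdf x))).
  have := integrableZl measurableT `|s| (affine_moment_integrable 0).
  by apply: eq_integrable => // x _ /=; rewrite add0r -EFinM.
have iT' : mu.-integrable setT
    (EFin \o (fun x => 2 * c * (`|s| * (`|x| * pdf x)))).
  by have := integrableZl measurableT (2 * c) iT; apply: eq_integrable.
(* The difference of two densities is their sum minus twice their minimum, and the minimum is at
   least [c (1 + kappa |s| - |s| |x|) pdf x]. Here [b] collects the terms proportional to [pdf x];
   after integration the terms in [kappa] cancel and [2 - 2 c] remains. *)
pose b := 1 - 2 * c * (1 + gauss_abs_moment * `|s|).
have ib : mu.-integrable setT (EFin \o (fun x => b * pdf x)).
  by have := integrableZl measurableT b ipdf; apply: eq_integrable.
have isb : mu.-integrable setT (EFin \o (fun x => pdf (x - s) + b * pdf x)).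
  by have := integrableD measurableT is1 ib; apply: eq_integrable.
have iall : mu.-integrable setT (EFin \o (fun x => pdf (x - s) + b * pdf x
    + 2 * c * (`|s| * (`|x| * pdf x)))).
  by have := integrableD measurableT isb iT'; apply: eq_integrable.
apply: (@le_trans _ _ (\int[mu]_x (pdf (x - s) + b * pdf x
    + 2 * c * (`|s| * (`|x| * pdf x))))).
  apply: le_Rintegral => //.
    by have := integrable_abse iB; apply: eq_integrable.
  move=> x _; rewrite -mulrBr normrM.
  apply: (le_trans (ler_piMl _ (psi1 x))) => //.
  have p0 : 0 <= pdf x := normal_pdf_ge0 0 1 x.
  rewrite normal_pdf_shift.
  set k := expR _.
  rewrite -[X in `|_ - X|]mulr1 -mulrBr normrM ger0_norm//.
  have -> : pdf x * k + b * pdf x + 2 * c * (`|s| * (`|x| * pdf x)) =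
    pdf x * (k + b + 2 * c * (`|s| * `|x|)) by ring.
  apply: ler_wpM2l => //.
  pose m := expR (- (`|s| * `|x| + s ^+ 2 / 2)).
  have mc : c * (1 + gauss_abs_moment * `|s| - `|s| * `|x|) <= m.
    have -> : m = c * expR (gauss_abs_moment * `|s| - `|s| * `|x|).
      by rewrite /m /c -expRD; congr expR; ring.
    by apply: ler_wpM2l; [exact: expR_ge0|rewrite -addrA; exact: expR_ge1Dx].
  have mk : m <= k.
    rewrite ler_expR; have : - (s * x) <= `|s| * `|x| by rewrite -normrM -normrN ler_norm.
    by lra.
  have m1 : m <= 1.
    rewrite -expR0 ler_expR; have := sqr_ge0 s.
    have : 0 <= `|s| * `|x| by rewrite mulr_ge0.
    by lra.
  rewrite /b ler_norml; apply/andP; split; nra.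
rewrite RintegralD// RintegralD// RintegralZl// RintegralZl// RintegralZl//.
  rewrite is2 Rintegral_pdf01 -/gauss_abs_moment /b.
  by rewrite le_eqVlt; apply/orP; left; apply/eqP; ring.
by have := affine_moment_integrable 0; apply: eq_integrable => // x _ /=; rewrite add0r.
Qed.

Lemma is_derive_pdf (x : R) : is_derive x 1 pdf (- x * pdf x).
Proof.
have -> : pdf = normal_peak 1 \*: gauss by apply/funext => y; exact: normal_pdf01E.
have := @is_deriveZ _ _ _ gauss (normal_peak 1) x 1 _ (is_derive_gauss x).
by rewrite /GRing.scale/= mulrCA.
Qed.

End StandardGaussian.

(** * Characteristic function of the standard Gaussian *)

Section GaussianCharacteristicFunction.
Context {R : realType}.
Local Notation mu := (@lebesgue_measure R).
Local Notation pdf := (@normal_pdf R 0 1).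

Let w (a b x : R) := pdf x * sin (a * x + b).
Let w' (a b x : R) := pdf x * (a * cos (a * x + b) - x * sin (a * x + b)).

Let is_derive_w (a b x : R) : is_derive x 1 (w a b) (w' a b x).
Proof.
have := @is_deriveM _ _ _ _ x 1 _ _ (is_derive_pdf x) (is_derive_sin_affine a b x).
move=> h; rewrite (_ : w' a b x =
  pdf x *: (a * cos (a * x + b)) + sin (a * x + b) *: (- x * pdf x)) //.
by rewrite /GRing.scale/= /w'; ring.
Qed.

Let w'_le (a b x : R) : `|w' a b x| <= (`|a| + `|x|) * pdf x.
Proof.
rewrite /w' normrM mulrC (ger0_norm (normal_pdf_ge0 0 1 x)) ler_wpM2r ?normal_pdf_ge0//.
apply: (le_trans (ler_normB _ _)); rewrite !normrM.
apply: lerD; rewrite ler_piMr// ler_norml.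
  by rewrite cos_geN1 cos_le1.
by rewrite sin_geN1 sin_le1.
Qed.

Let continuous_affine (a b : R) : continuous (fun x : R => a * x + b).
Proof.
by move=> x; apply: cvgD; [apply: cvgM; [exact: cvg_cst|exact: cvg_id]|exact: cvg_cst].
Qed.

Let continuous_w' (a b : R) : continuous (w' a b).
Proof.
move=> x; apply: cvgM; first exact: (continuous_normal_pdf (oner_neq0 _)).
apply: cvgB; apply: cvgM.
- exact: cvg_cst.
- apply: continuous_comp; first exact: continuous_affine.
  exact: continuous_cos.
- exact: cvg_id.
- apply: continuous_comp; first exact: continuous_affine.
  exact: continuous_sin.
Qed.

Let w'_integrable (a b : R) : mu.-integrable setT (EFin \o w' a b).
Proof.
apply: (le_integrable measurableT _ _ (affine_moment_integrable `|a|)).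
  apply/measurable_EFinP. apply: continuous_measurable_fun. move=> x; apply: continuous_w'.
by move=> x _; rewrite /= lee_fin (le_trans (w'_le a b x))// ler_norm.
Qed.

(** The cases [e = 1] and [e = - 1] are the two ends of the line. The factor 2 in the bound comes
    from [exp (m^2 / 2) >= 1 + m^2 / 2 >= m / 2]. *)
Let w_cvg0 (a b : R) (e : R) : `|e| = 1 ->
  w a b (e * n.+1%:R) @[n --> \oo] --> (0 : R).
Proof.
move=> e1; apply/norm_cvg0P.
apply: (@squeeze_cvgr _ _ _ _ (cst 0) (fun n => (normal_peak 1 * 2) * harmonic n)).
- apply: nearW => n; rewrite normr_ge0/= /w normrM.
  apply: (@le_trans _ _ (pdf (e * n.+1%:R))).
    rewrite (ger0_norm (normal_pdf_ge0 0 1 _)) ler_piMr ?normal_pdf_ge0//.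
    by rewrite ler_norml sin_geN1 sin_le1.
  rewrite normal_pdf01E -mulrA ler_wpM2l ?normal_peak_ge0//.
  rewrite exprMn -(real_normK (num_real e)) e1 expr1n mul1r /harmonic/=.
  set m : R := n.+1%:R; have m0 : 0 < m by rewrite ltr0n.
  rewrite mulNr expRN -[leRHS]invrK lef_pV2 ?posrE ?expR_gt0//; last first.
    by rewrite invr_gt0 mulr_gt0 ?invr_gt0.
  rewrite invfM invrK; apply: (le_trans _ (expR_ge1Dx _)).
  have := sqr_ge0 (m - 1); by nra.
- exact: cvg_cst.
- rewrite -[X in _ --> X](mulr0 (normal_peak 1 * 2)).
  by apply: cvgM; [exact: cvg_cst|exact: cvg_harmonic].
Qed.

(** The integrand is the derivative of [w], which vanishes at both ends: the fundamental theorem of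
    calculus on growing intervals, then dominated convergence. *)
Let Rintegral_w' (a b : R) : \int[mu]_x w' a b x = 0.
Proof.
pose I n : set R := `[- n.+1%:R, n.+1%:R]%classic.
have int n : \int[mu]_(x in I n) w' a b x = w a b n.+1%:R - w a b (- n.+1%:R).
  rewrite /Rintegral (@continuous_FTC2 _ (w' a b) (w a b))//.
  - by rewrite (@lt_trans _ _ 0)// oppr_lt0.
  - by apply: continuous_subspaceT; exact: continuous_w'.
  - have dw x : derivable (w a b) x 1 by have [] := is_derive_w a b x.
    have cw x : {for x, continuous (w a b)}.
      exact/differentiable_continuous/derivable1_diffP/dw.
    split => //.
    + exact/cvg_at_right_filter/cw.
    + exact/cvg_at_left_filter/cw.
  - by move=> x _; rewrite derive1E; have [] := is_derive_w a b x.
have c1 : \int[mu]_(x in I n) w' a b x @[n --> \oo] --> (0 : R).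
  have h1 := @w_cvg0 a b 1 (normr1 _); have h2 := @w_cvg0 a b (- 1) (normrN1 _).
  have h3 := cvgB h1 h2; rewrite subr0 in h3.
  have -> : (fun n => \int[mu]_(x in I n) w' a b x) =
      (fun n => w a b (1 * n.+1%:R) - w a b (- 1 * n.+1%:R)).
    by apply/funext => n; rewrite int mul1r mulN1r.
  exact: h3.
suff c2 : \int[mu]_(x in I n) w' a b x @[n --> \oo] --> \int[mu]_x w' a b x.
  have /cvg_lim <- // := c2.
  by have /cvg_lim -> := c1.
under eq_fun do rewrite Rintegral_mkcond.
have mw : measurable_fun setT (w' a b).
  by apply/measurable_EFinP; exact: (measurable_int mu (w'_integrable a b)).
apply: fine_cvg; rewrite fineK; last exact: integrable_fin_num (w'_integrable a b).

have := (@dominated_cvg _ _ R mu setT measurableT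
    (fun n x => ((w' a b \_ (I n)) x)%:E) (EFin \o w' a b)
    (fun x => ((`|a| + `|x|) * pdf x)%:E)). apply => //.
- move=> n; apply/measurable_EFinP.
  have mI : measurable (I n) by exact: measurable_itv.
  by have := (measurable_restrictT (w' a b) mI).1 (measurable_funTS mw).
- move=> x _; apply: cvg_near_cst; near=> n.
  rewrite patchE mem_set// /I/= in_itv/= -ler_norml.
  have : (`|x| <= n%:R) by near: n; exact: nbhs_infty_ger.
  by move=> h; rewrite (le_trans h)// ler_nat.
- exact: affine_moment_integrable.
- move=> n x _; rewrite lee_fin patchE; case: ifP => _; first exact: w'_le.
  by rewrite normr0 mulr_ge0 ?normal_pdf_ge0// addr_ge0.
Unshelve. all: by end_near. Qed.

(* [d/ds (exp (s^2/2) cos (s x + b) f x) = exp (s^2/2) d/dx (f x sin (s x + b))],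
   so that the integral of the left-hand function does not depend on [s]. *)
Lemma normal_char_fun (s b : R) :
  \int[normal_prob (0:R) 1]_x cos (s * x + b) = expR (- (s ^+ 2 / 2)) * cos b.
Proof.
have cos1 (y : R) : `|cos y| <= 1 by rewrite ler_norml cos_geN1 cos_le1.
have mcos (a : R) : measurable_fun setT (fun x : R => cos (a * x + b)).
  apply: continuous_measurable_fun => x; apply: continuous_comp.
    exact: continuous_affine.
  exact: continuous_cos.
pose f (t x : R) := expR (t ^+ 2 / 2) * (cos (t * x + b) * pdf x).
have icos t : mu.-integrable setT (EFin \o (fun x => cos (t * x + b) * pdf x)).
  apply: (le_integrable measurableT _ _ (integrable_normal_pdf 0 1)).
    apply/measurable_EFinP; apply: measurable_funM; first exact: mcos.
    exact: measurable_pdf01.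
  by move=> x _; rewrite /= lee_fin normrM ler_piMl.
have intf t : mu.-integrable setT (EFin \o f t).
  by have := integrableZl measurableT (expR (t ^+ 2 / 2)) (icos t); apply: eq_integrable.
pose f' (t x : R) := expR (t ^+ 2 / 2) * w' t b x.
have df (t x : R) : is_derive t 1 (f ^~ x) (f' t x).
  have h1 : is_derive t 1 (fun t : R => expR (t ^+ 2 / 2)) (t * expR (t ^+ 2 / 2)).
    have h : is_derive t 1 (fun y : R => y ^+ 2 / 2) t.
      have -> : (fun y : R => y ^+ 2 / 2) = (fun y : R => (2^-1) *: y ^+ 2).
        by apply/funext => y; rewrite /GRing.scale/=; field.
      by apply: is_derive_eq; rewrite /GRing.scale/=; field.
    have := @is_derive1_comp _ expR _ t _ _ (is_derive_expR _) h.
    by rewrite mulrC.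
  have h2 : is_derive t 1 (fun t : R => cos (t * x + b)) (- x * sin (t * x + b)).
    have := is_derive_cos_affine x b t.
    by rewrite (mulrC x t); under eq_fun do rewrite mulrC.
  have h3 : is_derive t 1 (fun t : R => pdf x *: cos (t * x + b))
      (pdf x *: (- x * sin (t * x + b))).
    exact: is_deriveZ.
  have h := @is_deriveM _ _ _ _ t 1 _ _ h1 h3.
  rewrite (_ : f ^~ x = (fun t : R => expR (t ^+ 2 / 2)) *
      (fun t : R => pdf x *: cos (t * x + b))); last first.
    by apply/funext => y; rewrite /f /GRing.scale/= !fctE; ring.
  rewrite (_ : f' t x = expR (t ^+ 2 / 2) *: (pdf x *: (- x * sin (t * x + b))) +
    (pdf x *: cos (t * x + b)) *: (t * expR (t ^+ 2 / 2))) //.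
  by rewrite /GRing.scale/= /f' /w'; ring.
pose F t := \int[mu]_x f t x.
have dF (t : R) : is_derive t 1 F 0.
  (* Differentiating under the integral needs one integrable bound for all parameters near [t]. On
     this interval [|u| <= |t| + 1], which gives [G]. *)
  pose I : set R := `]t - 1, t + 1[%classic.
  have It : I t by rewrite /I/= in_itv/=; apply/andP; split; lra.
  pose G x := expR ((`|t| + 1) ^+ 2 / 2) * ((`|t| + 1 + `|x|) * pdf x).
  have G0 x : 0 <= G x.
    by rewrite mulr_ge0 ?expR_ge0// mulr_ge0 ?normal_pdf_ge0// !addr_ge0.
  have iG : mu.-integrable setT (EFin \o G).
    have := integrableZl measurableT (expR ((`|t| + 1) ^+ 2 / 2))
      (affine_moment_integrable (`|t| + 1)).
    by apply: eq_integrable.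
  have d1E (u x : R) : partial1of2 f u x = f' u x.
    by rewrite partial1of2E; have [] := df u x.
  have Gub (u x : R) : I u -> [set: R] x -> `|partial1of2 f u x| <= G x.
    rewrite /I/= in_itv/= => /andP[u1 u2] _; rewrite d1E /f' normrM.
    have ut : `|u| <= `|t| + 1.
      have : `|u - t| <= 1 by rewrite ler_norml; apply/andP; split; lra.
      by move=> h; rewrite -[u](subrK t) (le_trans (ler_normD _ _))// addrC lerD2l.
    rewrite ger0_norm ?expR_ge0// ler_pM ?expR_ge0//.
      rewrite ler_expR ler_pM2r// -(real_normK (num_real u)).
      by rewrite lerXn2r ?nnegrE// addr_ge0.
    by rewrite (le_trans (w'_le u b x))// ler_wpM2r ?normal_pdf_ge0// lerD2r.
  have derf (u x : R) : I u -> [set: R] x -> derivable (f ^~ x) u 1.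
    by move=> _ _; have [] := df u x.
  have der := @derivable_under_integral _ _ _ mu f setT measurableT t _ _ It
    (fun u _ => intf u) derf G G0 iG Gub.
  apply: DeriveDef => //; rewrite -derive1E.
  rewrite (@differentiation_under_integral _ _ _ mu f setT measurableT t _ _ It
    (fun u _ => intf u) derf G G0 iG Gub).
  under eq_Rintegral do rewrite d1E.
  by rewrite RintegralZl// Rintegral_w' mulr0.
have := is_derive_0_is_cst s 0 dF.
rewrite (Rintegral_normal_prob (mcos s) (fun x => cos1 _)).
rewrite /F /f RintegralZl// RintegralZl//.
rewrite expr0n/= mul0r expR0 mul1r.
under [in X in _ = X -> _]eq_Rintegral do rewrite mul0r add0r.
rewrite RintegralZl//; last exact: integrable_normal_pdf.
rewrite Rintegral_pdf01 mulr1 => <-.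
by rewrite mulrA -expRD addNr expR0 mul1r.
Qed.

End GaussianCharacteristicFunction.

(** * Real inner products, and separability *)

Lemma borel_continuous_measurable {R : realType} {H : normedModType R}
  (f : H -> R) : continuous f -> measurable_fun setT (f : BorelT H -> R).
Proof.
move=> /continuousP cf; apply: (measurability _ (RGenOpens.measurableE R)).
move=> _ [_ [a [b ->] <-]]; rewrite setTI; apply: sub_sigma_algebra.
exact/cf/interval_open.
Qed.

Section InnerProduct.
Context {R : realType} {H : normedModType R}.

Record inner_product (ip : H -> H -> R) : Prop := InnerProduct {
  ipC : forall x y, ip x y = ip y x;
  ipDl : forall x y z, ip (x + y) z = ip x z + ip y z;
  ipZl : forall a x y, ip (a *: x) y = a * ip x y;
  ipxx : forall x, ip x x = `|x| ^+ 2 }.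

Variable ip : H -> H -> R.
Hypothesis ipP : inner_product ip.

Lemma ipDr x y z : ip x (y + z) = ip x y + ip x z.
Proof. by rewrite (ipC ipP) (ipDl ipP) !(ipC ipP x). Qed.

Lemma ipZr a x y : ip x (a *: y) = a * ip x y.
Proof. by rewrite (ipC ipP) (ipZl ipP) (ipC ipP x). Qed.

Lemma ip0l x : ip 0 x = 0.
Proof. by rewrite -(scale0r (0 : H)) (ipZl ipP) mul0r. Qed.

Lemma ip0r x : ip x 0 = 0.
Proof. by rewrite (ipC ipP) ip0l. Qed.

Lemma ipNl x y : ip (- x) y = - ip x y.
Proof. by rewrite -scaleN1r (ipZl ipP) mulN1r. Qed.

Lemma ipNr x y : ip x (- y) = - ip x y.
Proof. by rewrite (ipC ipP) ipNl (ipC ipP x). Qed.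

Lemma ipBl x y z : ip (x - y) z = ip x z - ip y z.
Proof. by rewrite (ipDl ipP) ipNl. Qed.

Lemma ipBr x y z : ip x (y - z) = ip x y - ip x z.
Proof. by rewrite ipDr ipNr. Qed.

Lemma ip_sumr I (r : seq I) (F : I -> H) x :
  ip x (\sum_(i <- r) F i) = \sum_(i <- r) ip x (F i).
Proof.
elim: r => [|a r IH]; first by rewrite !big_nil ip0r.
by rewrite !big_cons ipDr IH.
Qed.

(** The squared norm of [|x|^2 y - <x, y> x] is nonnegative and equals
    [|x|^2 (|x|^2 |y|^2 - <x, y>^2)]. *)
Lemma cauchy_schwarz x y : `|ip x y| <= `|x| * `|y|.
Proof.
have [->|x0] := eqVneq x 0; first by rewrite ip0l !normr0 mul0r.
have px : 0 < `|x| ^+ 2 by rewrite exprn_gt0// normr_gt0.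
rewrite -(@ler_pXn2r _ 2)// ?nnegrE ?mulr_ge0// real_normK ?num_real// exprMn.
have : 0 <= ip (`|x| ^+ 2 *: y - ip x y *: x) (`|x| ^+ 2 *: y - ip x y *: x).
  by rewrite (ipxx ipP) sqr_ge0.
rewrite !ipBl !ipBr !(ipZl ipP) !ipZr !(ipxx ipP) (ipC ipP y x) => h.
rewrite -(ler_pM2l px) -subr_ge0; apply: le_trans h _.
by rewrite le_eqVlt; apply/orP; left; apply/eqP; ring.
Qed.

Lemma ip_continuous x : continuous (ip x).
Proof.
move=> y; apply/cvgrPdist_le => e e0.
near=> z.
rewrite -ipBr (le_trans (cauchy_schwarz _ _))//.
apply: (@le_trans _ _ ((`|x| + 1) * `|y - z|)).
  by rewrite ler_wpM2r// lerDl.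
rewrite mulrC -ler_pdivlMr; last by rewrite ltr_wpDl.
near: z; apply: cvgr_dist_le; first exact: cvg_id.
by rewrite divr_gt0// ltr_wpDl.
Unshelve. all: by end_near. Qed.

Definition orthonormal (s : seq H) : Prop :=
  forall i j, (i < size s)%N -> (j < size s)%N -> ip s`_i s`_j = (i == j)%:R.

Definition proj (s : seq H) (x : H) : H := \sum_(i < size s) ip s`_i x *: s`_i.

Lemma proj_orthogonal s x j : orthonormal s -> (j < size s)%N ->
  ip s`_j (x - proj s x) = 0.
Proof.
move=> os js; rewrite ipBr /proj ip_sumr (bigD1 (Ordinal js))//= ipZr os// eqxx.
rewrite mulr1 big1 ?addr0 ?subrr// => i ij.
rewrite ipZr os//; case: eqVneq => [ji|_]; last by rewrite mulr0.
by move: ij; rewrite -val_eqE/= ji eqxx.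
Qed.

Lemma ip_proj_sub s x : orthonormal s -> ip (proj s x) (x - proj s x) = 0.
Proof.
move=> os; rewrite (ipC ipP) {2}/proj ip_sumr big1// => i _.
by rewrite ipZr [X in _ * X](ipC ipP) proj_orthogonal// mulr0.
Qed.

Lemma bessel s x : orthonormal s ->
  \sum_(i < size s) ip s`_i x ^+ 2 <= `|x| ^+ 2.
Proof.
move=> os; have sp := ip_proj_sub x os.
have : 0 <= ip (x - proj s x) (x - proj s x) by rewrite (ipxx ipP) sqr_ge0.
rewrite ipBl sp subr0 ipBr (ipxx ipP) subr_ge0 /proj ip_sumr.
by under eq_bigr do rewrite ipZr (ipC ipP x) -expr2.
Qed.

(** The residual is orthogonal to the projection, so pairing it with itself or with [x] gives the
    same number; the norm bound is then Cauchy-Schwarz. *)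
Lemma norm_sub_proj_le s x : orthonormal s ->
  `|x - proj s x| ^+ 2 = ip x (x - proj s x) /\ `|x - proj s x| <= `|x|.
Proof.
move=> os; have sp := ip_proj_sub x os.
have e : `|x - proj s x| ^+ 2 = ip x (x - proj s x).
  by rewrite -(ipxx ipP) ipBl sp subr0.
split=> //; have [->|y0] := eqVneq (x - proj s x) 0; first by rewrite normr0.
rewrite -(@ler_pM2r _ `|x - proj s x|) ?normr_gt0// -expr2 e.
exact: le_trans (ler_norm _) (cauchy_schwarz _ _).
Qed.

Lemma orthonormal_rcons s e : orthonormal s -> `|e| = 1 ->
  (forall j, (j < size s)%N -> ip s`_j e = 0) -> orthonormal (rcons s e).
Proof.
move=> os e1 oe i j; rewrite size_rcons !nth_rcons !ltnS [(i <= _)%N]leq_eqVlt.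
move=> /predU1P[->|is1]; rewrite leq_eqVlt => /predU1P[->|js1].
- by rewrite ltnn eqxx (ipxx ipP) e1 expr1n.
- by rewrite ltnn eqxx js1 (ipC ipP) oe// gtn_eqF.
- by rewrite ltnn eqxx is1 oe// ltn_eqF.
- by rewrite is1 js1 os.
Qed.

End InnerProduct.

(** * Separability from finite trace and dense range *)

Section Separability.
Context {R : realType} {H : normedModType R}.
Variable ip : H -> H -> R.
Hypothesis ipP : inner_product ip.
Variable Q : {linear H -> H}.
Hypothesis Qsym : forall f g, ip (Q f) g = ip (Q g) f.
Hypothesis Qge0 : forall f, 0 <= ip (Q f) f.
Variable T : R.
Hypothesis Qtrace : forall s, orthonormal ip s ->
  \sum_(i < size s) ip (Q s`_i) s`_i <= T.
Hypothesis Qdense : forall (x : H) (e : R), 0 < e -> exists y : H, `|Q y - x| < e.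

Let traces : set R :=
  [set r | exists2 s, orthonormal ip s & r = \sum_(i < size s) ip (Q s`_i) s`_i].

Let has_sup_traces : has_sup traces.
Proof.
split; first by exists 0, [::]; [move=> i j|rewrite big_ord0].
by exists T => r [s os ->]; exact: Qtrace.
Qed.

(* An orthonormal family whose trace is within [d] of the supremum leaves at
   most [d] for any further unit vector. *)
Let almost_full (d : R) : 0 < d -> exists s, orthonormal ip s /\
  forall y, (forall j, (j < size s)%N -> ip s`_j y = 0) ->
    ip (Q y) y <= d * `|y| ^+ 2.
Proof.
move=> d0; have [_ [s os ->] hs] := sup_adherent d0 has_sup_traces.
exists s; split=> // y oy.
have [->|y0] := eqVneq y 0; first by rewrite linear0 ip0l// normr0 expr0n/= mulr0.
have ny : 0 < `|y| by rewrite normr_gt0.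
pose e := `|y|^-1 *: y.
have e1 : `|e| = 1 by rewrite normrZ ger0_norm ?invr_ge0// mulVf// gt_eqF.
have oe j : (j < size s)%N -> ip s`_j e = 0 by move=> js; rewrite ipZr// oy// mulr0.
have : \sum_(i < size (rcons s e)) ip (Q (rcons s e)`_i) (rcons s e)`_i <= sup traces.
  apply: sup_upper_bound => //; exists (rcons s e) => //.
  exact: orthonormal_rcons.
rewrite size_rcons big_ord_recr/= nth_rcons ltnn eqxx.
under eq_bigr do rewrite nth_rcons ltn_ord.
move=> h; have : ip (Q e) e <= d by move: h hs; lra.
rewrite linearZ/= (ipZl ipP) (ipZr ipP) mulrA -expr2 exprVn.
by rewrite -ler_pdivrMr ?exprn_gt0// mulrC.
Qed.

(** Cauchy-Schwarz for the form [<Q f, g>], with a free parameter in place of the square roots: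
    expand the form at [t f - g] and divide by [t]. *)
Let Q_cs (f g : H) (t : R) : 0 < t ->
  2 * ip (Q f) g <= t * ip (Q f) f + t^-1 * ip (Q g) g.
Proof.
move=> t0; have := Qge0 (t *: f - g).
rewrite linearB linearZ/= !(ipBl ipP) !(ipBr ipP) !(ipZl ipP) !(ipZr ipP) (Qsym g f).
move=> h; rewrite -(ler_pM2l t0) mulrDr mulrA [t * (t^-1 * _)]mulrA mulfV ?gt_eqF//.
by move: h; lra.
Qed.

(** Let [y] be the residual of [Q z] after projection on the nearly full family [S n]. Then
    [|y|^2 = <Q z, y>] is controlled by [<Q y, y>], which is at most [|Q z|^2 / (n + 1)]. So
    rational combinations of the families approximate the range of [Q], which is dense. *)
Lemma dense_sequence : exists D : nat -> H,
  forall (x : H) (e : R), 0 < e -> exists n, `|D n - x| < e.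
Proof.
have /choice[S SP] : forall n : nat, exists s, orthonormal ip s /\
    forall y, (forall j, (j < size s)%N -> ip s`_j y = 0) ->
    ip (Q y) y <= n.+1%:R^-1 * `|y| ^+ 2.
  by move=> n; apply: almost_full; rewrite invr_gt0.
pose comb (s : seq H) (q : seq rat) : H := \sum_(i < size s) ratr q`_i *: s`_i.
(* An index encodes a family and its rational coefficients; an index that encodes nothing is sent to
   0. *)
exists (fun m => if @unpickle (nat * seq rat)%type m is Some (n, q) then comb (S n) q
                 else 0).
move=> x e e0; have e2 : 0 < e / 3 by rewrite divr_gt0.
have [z zx] := Qdense x e2.
suff [n nP] : exists n, `|Q z - proj ip (S n) (Q z)| < e / 3.
  set s := S n in nP; have [os _] := SP n.
  have d0 : 0 < e / 3 / (size s).+1%:R by rewrite divr_gt0.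
  have /choice[r rP] : forall i : nat, exists r : rat,
      `|ratr r - ip s`_i (Q z)| < e / 3 / (size s).+1%:R.
    move=> i; have [|r] := @rat_in_itvoo R (ip s`_i (Q z))
      (ip s`_i (Q z) + e / 3 / (size s).+1%:R); first by rewrite ltrDl.
    rewrite in_itv/= => /andP[r1 r2]; exists r.
    by rewrite gtr0_norm ?subr_gt0// ltrBlDl.
  exists (pickle (n, mkseq r (size s))); rewrite pickleK.
  have cp : `|comb s (mkseq r (size s)) - proj ip s (Q z)| < e / 3.
    rewrite /comb /proj -sumrB.
    apply: le_lt_trans (ler_norm_sum _ _ _) _.
    apply: (@le_lt_trans _ _ (\sum_(i < size s) (e / 3 / (size s).+1%:R))).
      apply: ler_sum => i _; rewrite nth_mkseq// -scalerBl normrZ.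
      have -> : `|s`_i| = 1.
        apply/eqP; rewrite -sqrp_eq1 ?normr_ge0// -(ipxx ipP) os// eqxx.
        by [].
      by rewrite mulr1 ltW.
    rewrite sumr_const card_ord -[X in X < _]mulr_natr.
    apply: (@lt_le_trans _ _ (e / 3 / (size s).+1%:R * (size s).+1%:R)).
      by rewrite ltr_pM2l// ltr_nat.
    by rewrite divfK.
  rewrite -/s.
  have -> : comb s (mkseq r (size s)) - x = (comb s (mkseq r (size s)) - proj ip s (Q z))
     - (Q z - proj ip s (Q z)) + (Q z - x).
    by rewrite opprB !subrKA.
  apply: le_lt_trans (ler_normD _ _) _.
  apply: (@lt_le_trans _ _ (e / 3 + e / 3 + e / 3)); last by lra.
  apply: ltrD => //; apply: le_lt_trans (ler_normB _ _) _; exact: ltrD.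
pose d := e / 3; have d0 : 0 < d by [].
(* The two terms of [Q_cs] are to be less than [d^2] each: [t] is chosen for the first and
   [n > M - 1] for the second. The added 1 keeps the denominator positive. *)
pose t := d ^+ 2 / (ip (Q z) z + 1).
have qz1 : 0 < ip (Q z) z + 1 by rewrite ltr_wpDl.
have t0 : 0 < t by rewrite divr_gt0// exprn_gt0.
pose M := `|Q z| ^+ 2 * t^-1 / d ^+ 2.
have M0 : 0 <= M by rewrite !mulr_ge0// ?invr_ge0 ?exprn_ge0// ltW.
exists (Num.truncn M).
set n := Num.truncn M; have Mn : M < n.+1%:R by exact: truncnS_gt.
have [os hS] := SP n.
set y := Q z - _; have [ey ley] := norm_sub_proj_le ipP (Q z) os.
rewrite -(@ltr_pXn2r _ 2)// ?nnegrE// ?(ltW d0)//.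
rewrite -/y in ey ley; rewrite ey.
have := Q_cs z y t0; have := hS y (fun j js => proj_orthogonal ipP (Q z) os js).
move=> h1 h2.
have h3 : t * ip (Q z) z < d ^+ 2.
  rewrite /t mulrAC ltr_pdivrMr// ltr_pM2l ?exprn_gt0// ltrDl//.
have h4 : t^-1 * ip (Q y) y < d ^+ 2.
  apply: (@le_lt_trans _ _ (t^-1 * (n.+1%:R^-1 * `|Q z| ^+ 2))).
    rewrite ler_wpM2l ?invr_ge0 ?(ltW t0)// (le_trans h1)// ler_wpM2l ?invr_ge0//.
    by rewrite lerXn2r ?nnegrE.
  have -> : t^-1 * (n.+1%:R^-1 * `|Q z| ^+ 2) = `|Q z| ^+ 2 * t^-1 / n.+1%:R.
    by rewrite mulrCA mulrC (mulrC t^-1).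
  by move: Mn; rewrite /M !ltr_pdivrMr ?exprn_gt0// [n.+1%:R * _]mulrC.
by rewrite -/d; move: h2 h3 h4; lra.
Qed.

(** A closed ball is the intersection of its supporting half-spaces, and the normals of a dense
    sequence are enough: a point outside the ball is cut off by some [D k] close to [y - a]. *)
Let closed_ball_in (D : nat -> H) (S : set (set H)) (a : H) (r : R) :
  (forall (x : H) (e : R), 0 < e -> exists n, `|D n - x| < e) ->
  sigma_algebra setT S -> (forall g c, S [set y | ip g y <= c]) -> 0 <= r ->
  S [set y | `|y - a| <= r].
Proof.
move=> DP [S0 SC SU] Shalf r0.
have -> : [set y | `|y - a| <= r] =
    ~` \bigcup_k ~` [set y | ip (D k) y <= r * `|D k| + ip (D k) a].
  rewrite setC_bigcup; apply/seteqP; split => [y /= ya k _|y h].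
    rewrite setCK/= -lerBlDr -(ipBr ipP) mulrC.
    apply: (le_trans (ler_norm _)); apply: (le_trans (cauchy_schwarz ipP _ _)).
    by rewrite ler_wpM2l.
  rewrite /= leNgt; apply/negP => ra.
  set z := y - a in ra; have z0 : 0 < `|z| by apply: le_lt_trans ra.
  (* Chosen so that [e (|z| + r) < (|z| - r) |z|], which contradicts the estimate of [|z|^2]
     obtained from [|D k - z| < e]. *)
  pose e := (`|z| - r) * `|z| / (`|z| + r + 1) / 2.
  have e0 : 0 < e.
    by rewrite !divr_gt0// ?mulr_gt0 ?subr_gt0// ltr_wpDl// addr_ge0.
  have [k kz] := DP z _ e0.
  have := h k Logic.I; rewrite setCK/= -lerBlDr -(ipBr ipP) -/z => hk.
  have h1 : `|z| ^+ 2 <= e * `|z| + r * (`|z| + e).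
    rewrite -(ipxx ipP) -[X in ip X z](subrK (D k)) (ipDl ipP) lerD//.
      apply: (le_trans (ler_norm _)); apply: (le_trans (cauchy_schwarz ipP _ _)).
      by rewrite ler_wpM2r// distrC ltW.
    apply: (le_trans hk); rewrite ler_wpM2l// -[D k](subrK z).
    by rewrite (le_trans (ler_normD _ _))// addrC lerD2l ltW.
  have : e * (`|z| + r) < (`|z| - r) * `|z|.
    have p : 0 < (`|z| + r + 1) * 2 by rewrite mulr_gt0// ltr_wpDl// addr_ge0.
    have ee : e * ((`|z| + r + 1) * 2) = (`|z| - r) * `|z|.
      by rewrite /e; field; rewrite gt_eqF// ltr_wpDl// addr_ge0.
    rewrite -ee ltr_pM2l//; have : 0 <= `|z| + r by rewrite addr_ge0.
    by lra.
  by move: h1; lra.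
have SCC A : S A -> S (~` A) by move=> SA; rewrite -setTD; exact: SC.
by apply/SCC/SU => k; apply/SCC/Shalf.
Qed.

Lemma borel_sub_halfspaces (S : set (set H)) :
  sigma_algebra setT S -> (forall g c, S [set y | ip g y <= c]) ->
  <<s @open H >> `<=` S.
Proof.
move=> sS Shalf; apply: smallest_sub => // B oB.
have [D DP] := dense_sequence; have [S0 SC SU] := sS.
pose b n k : set H := [set y | `|y - D n| <= k.+1%:R^-1].
(* Balls that are not inside [B] are replaced by the empty set, so that the union runs over all
   pairs of indices. *)
have -> : B = \bigcup_n \bigcup_k (if pselect (b n k `<=` B) then b n k else set0).
  apply/seteqP; split => [y By|y [n _ [k _]]]; last by case: pselect => // h /h.
  have [e /= e0 eB] := (nbhs_ballP _ _).1 (open_nbhs_nbhs (conj oB By)).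
  pose k := Num.truncn (2 / e); have ke : k.+1%:R^-1 < e / 2.
    rewrite -[e / 2]invrK ltf_pV2 ?posrE ?invr_gt0 ?divr_gt0// invf_div.
    exact: truncnS_gt.
  have [n nP] : exists n, `|D n - y| < k.+1%:R^-1 by apply: DP; rewrite invr_gt0.
  exists n => //; exists k => //; case: pselect => [bB|]; first by rewrite /b/= distrC ltW.
  case=> z; rewrite /b/= => zD; apply: eB; rewrite -ball_normE/=.
  rewrite -(subrKA (D n)) (le_lt_trans (ler_normD _ _))//.
  rewrite (distrC y) (distrC _ z) [ltRHS]splitr.
  by apply: ltrD; [exact: lt_trans nP ke|exact: le_lt_trans zD ke].
apply: (SU) => n; apply: (SU) => k; case: pselect => [bB|] //=.
by apply: (closed_ball_in _ DP sS Shalf); rewrite invr_ge0.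
Qed.

End Separability.

(** * Laws with the same characteristic functional *)

Section SignIteration.
Context {R : realType}.

(** The Newton-Schulz iteration for the sign: an odd cubic with fixed points -1, 0, 1 that maps
    [[-1, 1]] to itself and satisfies [1 - sgn_step s = (1 - s)^2 (2 + s) / 2]. Being a polynomial,
    it stays inside any algebra of functions. *)
Definition sgn_step (s : R) : R := (3 * s - s ^+ 3) / 2.

Let sgn_stepN s : sgn_step (- s) = - sgn_step s.
Proof. by rewrite /sgn_step; field. Qed.

Let iter_sgn_stepN n s : iter n sgn_step (- s) = - iter n sgn_step s.
Proof. by elim: n => //= n ->; rewrite sgn_stepN. Qed.

Let iter_sgn_step_pos (t : R) n : 0 < t -> t <= 1 ->
  [/\ t <= iter n sgn_step t, iter n sgn_step t <= 1 &
      1 - iter n sgn_step t <= (1 - t / 2) ^+ n].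
Proof.
move=> t0 t1; elim: n => [|n [IH1 IH2 IH3]].
  by rewrite /= expr0; split => //; rewrite lerBlDl lerDr ltW.
rewrite iterS; set s := iter n _ _ in IH1 IH2 IH3 *.
have e1 : sgn_step s - s = s * (1 - s) * (1 + s) / 2 by rewrite /sgn_step; field.
have e2 : 1 - sgn_step s = (1 - s) * ((1 - s) * (2 + s) / 2).
  by rewrite /sgn_step; field.
have p1 : 0 <= 1 - s by rewrite subr_ge0.
have s0 : 0 < s by apply: lt_le_trans IH1.
have p : 0 <= s * (1 - s) * (1 + s) / 2.
  by rewrite divr_ge0// mulr_ge0 ?mulr_ge0 ?(ltW s0)// addr_ge0// ltW.
have p2 : 0 <= (1 - s) * (2 + s) / 2.
  by rewrite divr_ge0// mulr_ge0// addr_ge0// ltW.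
split; first by move: e1 p; lra.
  by rewrite -subr_ge0 e2 mulr_ge0.
(* The contraction factor is [(1 - s) (2 + s) / 2 = 1 - s / 2 - s^2 / 2], at most [1 - t / 2]
   because the iterates stay above [t]. *)
rewrite e2 exprSr; apply: ler_pM => //.
by have := sqr_ge0 s; rewrite expr2 => ?; move: IH1; nra.
Qed.

Lemma sgn_step_bound n (t : R) : `|t| <= 1 -> `|iter n sgn_step t| <= 1.
Proof.
have [t0|t0|->] := ltrgtP t 0.
- rewrite ltr0_norm// => t1; rewrite -[t]opprK iter_sgn_stepN normrN.
  have [|h1 h2 _] := @iter_sgn_step_pos (- t) n _ t1; first by rewrite oppr_gt0.
  by rewrite ger0_norm// (le_trans _ h1)// oppr_ge0 ltW.
- rewrite gtr0_norm// => t1; have [h1 h2 _] := iter_sgn_step_pos n t0 t1.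
  by rewrite ger0_norm// (le_trans _ h1)// ltW.
- move=> _; suff -> : iter n sgn_step 0 = 0 by rewrite normr0.
  by elim: n => //= n ->; rewrite /sgn_step expr0n/= mulr0 subr0 mul0r.
Qed.

Lemma sgn_step_cvg (t : R) : `|t| <= 1 ->
  iter n sgn_step t @[n --> \oo] --> Num.sg t.
Proof.
have pos (u : R) : 0 < u -> u <= 1 -> iter n sgn_step u @[n --> \oo] --> (1 : R).
  move=> u0 u1; apply: (@squeeze_cvgr _ _ _ _ (fun n => 1 - (1 - u / 2) ^+ n) (cst 1)).
  - apply: nearW => n; have [_ h1 h2] := iter_sgn_step_pos n u0 u1.
    by apply/andP; split=> //; move: h2; lra.
  - rewrite -[X in _ --> X](subr0 1); apply: cvgB; first exact: cvg_cst.
    by apply: cvg_expr; rewrite ger0_norm; lra.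
  - exact: cvg_cst.
have [t0|t0|->] := ltrgtP t 0.
- rewrite ltr0_norm// => t1; rewrite ltr0_sg//.
  have h : iter n sgn_step (- t) @[n --> \oo] --> (1 : R).
    by apply: pos => //; rewrite oppr_gt0.
  have -> : (fun n => iter n sgn_step t) = (fun n => - iter n sgn_step (- t)).
    by apply/funext => n; rewrite iter_sgn_stepN opprK.
  exact: cvgN h.
- by rewrite gtr0_norm// => t1; rewrite gtr0_sg//; exact: pos.
- move=> _; rewrite sgr0; apply: cvg_near_cst; apply: nearW => n.
  by elim: n => //= n ->; rewrite /sgn_step expr0n/= mulr0 subr0 mul0r.
Qed.

End SignIteration.

(** * The class generated by cosines under bounded limits *)

Section TrigonometricClass.
Context {R : realType} {H : normedModType R}.
Variable ip : H -> H -> R.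
Hypothesis ipP : inner_product ip.

(** An inductive predicate, so that an identity between integrals follows by induction from the case
    of cosines. The phase [c] supplies sines and constants and replaces complex exponentials.
    Products are not a constructor, since equality of integrals does not pass to products. *)
Inductive trig_closure : (H -> R) -> Prop :=
| trig_cos g c : trig_closure (fun y => cos (ip g y + c))
| trig_add f1 f2 : trig_closure f1 -> trig_closure f2 ->
    trig_closure (fun y => f1 y + f2 y)
| trig_scale a f : trig_closure f -> trig_closure (fun y => a * f y)
| trig_lim (f_ : nat -> H -> R) f M : (forall n, trig_closure (f_ n)) ->
    (forall n y, `|f_ n y| <= M) -> (forall y, f_ n y @[n --> \oo] --> f y) ->
    trig_closure f.

Lemma trig_ext f1 f2 : trig_closure f1 -> f1 =1 f2 -> trig_closure f2.
Proof. by move=> h /funext <-. Qed.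

Lemma trig_bounded f : trig_closure f -> exists M, forall y, `|f y| <= M.
Proof.
elim=> [g c|f1 f2 _ [M1 h1] _ [M2 h2]|a f1 _ [M h]|f_ f1 M _ _ fM ff].
- by exists 1 => y; rewrite ler_norml cos_geN1 cos_le1.
- by exists (M1 + M2) => y; rewrite (le_trans (ler_normD _ _))// lerD.
- by exists (`|a| * M) => y; rewrite normrM ler_wpM2l.
- exists M => y; have : `|f_ n y| @[n --> \oo] --> `|f1 y| by exact: cvg_norm.
  move=> h; rewrite -(cvg_lim (@Rhausdorff R) h); apply: limr_le.
    by apply/cvg_ex; exists `|f1 y|.
  by apply: nearW => n; exact: fM.
Qed.

Lemma trig_const a : trig_closure (fun=> a).
Proof.
apply: (trig_ext (trig_scale a (trig_cos 0 0))) => y.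
by rewrite (ip0l ipP) addr0 cos0 mulr1.
Qed.

Lemma trig_sub f1 f2 : trig_closure f1 -> trig_closure f2 ->
  trig_closure (fun y => f1 y - f2 y).
Proof.
move=> h1 h2; apply: (trig_ext (trig_add h1 (trig_scale (- 1) h2))) => y.
by rewrite mulN1r.
Qed.

(** The product-to-sum formula settles two cosines; the other constructors are linear or limits in
    the second factor. *)
Let trig_mul_cos g c f : trig_closure f ->
  trig_closure (fun y => cos (ip g y + c) * f y).
Proof.
elim=> [g' c'|f1 f2 _ h1 _ h2|a f1 _ h|f_ f1 M _ h fM ff].
- apply: (trig_ext (trig_scale 2^-1 (trig_add (trig_cos (g + g') (c + c'))
    (trig_cos (g - g') (c - c'))))) => y.
  rewrite (ipDl ipP) (ipBl ipP).
  have -> : ip g y + ip g' y + (c + c') = (ip g y + c) + (ip g' y + c') by ring.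
  have -> : ip g y - ip g' y + (c - c') = (ip g y + c) - (ip g' y + c') by ring.
  by rewrite cosD cosB; field.
- by apply: (trig_ext (trig_add h1 h2)) => y; rewrite mulrDr.
- by apply: (trig_ext (trig_scale a h)) => y; rewrite mulrCA.
- apply: (@trig_lim (fun n y => cos (ip g y + c) * f_ n y) _ M) => //.
  + move=> n y; rewrite normrM; apply: le_trans (fM n y).
    by rewrite ler_piMl// ler_norml cos_geN1 cos_le1.
  + by move=> y; apply: cvgM; [exact: cvg_cst|exact: ff].
Qed.

Lemma trig_mul f1 f2 : trig_closure f1 -> trig_closure f2 ->
  trig_closure (fun y => f1 y * f2 y).
Proof.
move=> t1 t2; have [M2 hM2] := trig_bounded t2.
elim: t1 => [g c|f f' _ h1 _ h2|a f _ h|f_ f M _ h fM ff].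
- exact: trig_mul_cos.
- by apply: (trig_ext (trig_add h1 h2)) => y; rewrite mulrDl.
- by apply: (trig_ext (trig_scale a h)) => y; rewrite mulrA.
- apply: (@trig_lim (fun n y => f_ n y * f2 y) _ (M * M2)) => //.
  + by move=> n y; rewrite normrM ler_pM.
  + by move=> y; apply: cvgM; [exact: ff|exact: cvg_cst].
Qed.

(** After rescaling into [[-1, 1]], the sign is a bounded limit of polynomials in [f], and the class
    is closed under products. *)
Lemma trig_sg f : trig_closure f -> trig_closure (fun y => Num.sg (f y)).
Proof.
move=> tf; have [M hM] := trig_bounded tf.
pose g y := (`|M| + 1)^-1 * f y.
have M1 : 0 < `|M| + 1 by rewrite ltr_wpDl.
have g1 y : `|g y| <= 1.
  rewrite normrM gtr0_norm ?invr_gt0// mulrC ler_pdivrMr// mul1r.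
  by rewrite (le_trans (hM y))// (le_trans (ler_norm M))// lerDl.
apply: (@trig_lim (fun n y => iter n sgn_step (g y)) _ 1).
- elim=> [|n IH] /=; first exact: trig_scale.
  apply: (trig_ext (trig_scale 2^-1 (trig_sub (trig_scale 3 IH)
    (trig_mul IH (trig_mul IH IH))))) => y.
  by rewrite /sgn_step; field.
- by move=> n y; exact: sgn_step_bound.
- move=> y; have := sgn_step_cvg (g1 y).
  by rewrite sgrM gtr0_sg ?invr_gt0// mul1r.
Qed.

Lemma trig_indic_gt0 f : trig_closure f ->
  trig_closure (\1_[set y | 0 < f y] : H -> R).
Proof.
move=> tf; have ts := trig_sg tf.
apply: (trig_ext (trig_scale 2^-1 (trig_add ts (trig_mul ts ts)))) => y.
rewrite indicE; have [h|h|h] := ltrgtP (f y) 0.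
- rewrite memNset/=; last by move=> /(lt_trans h); rewrite ltxx.
  by rewrite ltr0_sg//; field.
- by rewrite mem_set//= gtr0_sg//; field.
- rewrite memNset/=; last by rewrite h ltxx.
  by rewrite h sgr0; field.
Qed.

Let sets : set (set H) := [set B | trig_closure (\1_B : H -> R)].

Let indicU (A B : set H) (y : H) :
  (\1_(A `|` B) y : R) = 1 - (1 - \1_A y) * (1 - \1_B y).
Proof.
by rewrite !indicE in_setU; case: (y \in A); case: (y \in B) => /=; ring.
Qed.

Lemma trig_sigma_algebra : sigma_algebra setT sets.
Proof.
have sU A B : sets A -> sets B -> sets (A `|` B).
  move=> sA sB; apply: (trig_ext (trig_sub (trig_const 1)
    (trig_mul (trig_sub (trig_const 1) sA) (trig_sub (trig_const 1) sB)))) => y.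
  by rewrite indicU.
have s0 : sets set0.
  by apply: (trig_ext (trig_const 0)) => y; rewrite indicE in_set0.
split=> //.
- move=> A sA; apply: (trig_ext (trig_sub (trig_const 1) sA)) => y.
  by rewrite !indicE setTD in_setC; case: (y \in A); rewrite /= ?subrr ?subr0.
- move=> A sA; apply: (@trig_lim (fun n => \1_(\big[setU/set0]_(k < n) A k)) _ 1).
  + by elim=> [|n IH]; rewrite ?big_ord0// big_ord_recr/=; exact: sU.
  + by move=> n y; rewrite indicE; case: (_ \in _); rewrite ?normr0 ?normr1.
  + move=> y; apply: cvg_near_cst.
    have [[k _ Ak]|nA] := pselect ((\bigcup_k A k) y).
      near=> n; have h1 : (\bigcup_k A k) y by exists k.
      have h2 : (\big[setU/set0]_(k < n) A k) y.
        rewrite -bigcup_mkord; exists k => //=.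
        by near: n; exact: nbhs_infty_gt.
      by rewrite !indicE !mem_set.
    apply: nearW => n; have h : ~ (\big[setU/set0]_(k < n) A k) y.
      by rewrite -bigcup_mkord => -[k _ Ak]; apply: nA; exists k.
    by rewrite !indicE !memNset.
Unshelve. all: by end_near. Qed.

Lemma trig_halfspace g c : sets [set y | ip g y <= c].
Proof.
suff h : sets [set y | 0 < ip g y - c].
  have [_ sC _] := trig_sigma_algebra; have := sC _ h.
  congr sets; apply/seteqP; split => y /=.
    by move=> [_ /negP]; rewrite -leNgt subr_le0.
  by move=> yc; split=> //; apply/negP; rewrite -leNgt subr_le0.
(* The affine function is in general unbounded, hence outside the class. Its rescaled sine is
   inside, and has the same sign as soon as the argument is less than [pi] in absolute value. *)
apply: (@trig_lim (fun n => \1_[set y | 0 < sin (n.+1%:R^-1 * (ip g y - c))]) _ 1).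
- move=> n; apply: trig_indic_gt0.
  apply: (trig_ext (trig_cos (n.+1%:R^-1 *: g) (- (n.+1%:R^-1 * c) - pi / 2))) => y.
  rewrite (ipZl ipP) addrA -mulrBr cosB cos_pihalf sin_pihalf mulr0 add0r mulr1.
  by [].
- by move=> n y; rewrite indicE; case: (_ \in _); rewrite ?normr0 ?normr1.
- move=> y; apply: cvg_near_cst; set u := ip g y - c.
  near=> n.
  have n0 : (0 : R) < n.+1%:R^-1 by rewrite invr_gt0.
  have un : `|n.+1%:R^-1 * u| < pi.
    rewrite normrM gtr0_norm// mulrC ltr_pdivrMr//.
    rewrite mulrC -ltr_pdivrMr ?pi_gt0//.
    have : `|u| / pi <= n%:R by near: n; exact: nbhs_infty_ger.
    by move=> /le_lt_trans; apply; rewrite ltr_nat.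
  rewrite !indicE; congr (_%:R); congr nat_of_bool; apply/idP/idP; rewrite !inE/=.
    apply: contraTT; rewrite -!leNgt => u0.
    rewrite -oppr_ge0 -sinN; apply: sin_ge0_pi; rewrite -mulrN mulr_ge0 ?oppr_ge0 ?(ltW n0)//=.
    by rewrite (le_trans _ (ltW un))// mulrN -normrN ler_norm.
  move=> u0; apply: sin_gt0_pi; rewrite mulr_gt0//=.
  by rewrite (le_lt_trans _ un)// ler_norm.
Unshelve. all: by end_near. Qed.

Hypothesis hborel : forall S, sigma_algebra setT S ->
  (forall g c, S [set y | ip g y <= c]) -> <<s @open H >> `<=` S.

(** Measurability is carried along in the induction because additivity and bounded convergence of
    the integrals require it at each constructor. *)
Lemma trig_closure_eq (d1 d2 : measure_display) (T1 : measurableType d1)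
  (T2 : measurableType d2) (P1 : probability T1 R) (P2 : probability T2 R)
  (Y1 : T1 -> BorelT H) (Y2 : T2 -> BorelT H) :
  measurable_fun setT Y1 -> measurable_fun setT Y2 ->
  (forall g c, \int[P1]_w cos (ip g (Y1 w) + c) = \int[P2]_w cos (ip g (Y2 w) + c)) ->
  forall f, trig_closure f -> measurable_fun setT (f : BorelT H -> R) /\
    \int[P1]_w f (Y1 w) = \int[P2]_w f (Y2 w).
Proof.
move=> mY1 mY2 hcos f; elim=> [g c|f1 f2 t1 [m1 h1] t2 [m2 h2]|a f1 t [m h]|
  f_ f1 M t h fM ff].
- split=> //; apply: borel_continuous_measurable => y.
  apply: continuous_comp; last exact: continuous_cos.
  by apply: cvgD; [exact: ip_continuous|exact: cvg_cst].
- have [M1 b1] := trig_bounded t1; have [M2 b2] := trig_bounded t2.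
  split; first exact: measurable_funD.
  rewrite !RintegralD// ?h1 ?h2//.
  + apply: (@bounded_integrable _ _ _ _ _ M1) => //.
    exact: measurableT_comp.
  + by apply: (@bounded_integrable _ _ _ _ _ M2) => //; exact: measurableT_comp.
  + by apply: (@bounded_integrable _ _ _ _ _ M1) => //; exact: measurableT_comp.
  + by apply: (@bounded_integrable _ _ _ _ _ M2) => //; exact: measurableT_comp.
- have [M b] := trig_bounded t; split; first exact: measurable_funM.
  rewrite !RintegralZl// ?h//.
  + by apply: (@bounded_integrable _ _ _ _ _ M) => //; exact: measurableT_comp.
  + by apply: (@bounded_integrable _ _ _ _ _ M) => //; exact: measurableT_comp.
- have mf_ n : measurable_fun setT (f_ n : BorelT H -> R) by have [] := h n.
  split; first by apply: measurable_fun_cvg => // y _; exact: ff.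
  have c1 : \int[P1]_w f_ n (Y1 w) @[n --> \oo] --> \int[P1]_w f1 (Y1 w).
    by apply: (@bounded_Rintegral_cvg _ _ _ _ _ _ M) => // n; exact: (measurableT_comp (mf_ n)).
  have c2 : \int[P2]_w f_ n (Y2 w) @[n --> \oo] --> \int[P2]_w f1 (Y2 w).
    by apply: (@bounded_Rintegral_cvg _ _ _ _ _ _ M) => // n; exact: (measurableT_comp (mf_ n)).
  have e : (fun n => \int[P1]_w f_ n (Y1 w)) = (fun n => \int[P2]_w f_ n (Y2 w)).
    by apply/funext => n; have [_ ->] := h n.
  by rewrite -(cvg_lim (@Rhausdorff R) c1) -(cvg_lim (@Rhausdorff R) c2) e.
Qed.

Lemma trig_borel (B : set H) : <<s @open H >> B -> trig_closure (\1_B : H -> R).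
Proof. exact: (hborel trig_sigma_algebra trig_halfspace). Qed.

End TrigonometricClass.

(** * Translations of a Gaussian law *)

Section ProductFubini.
Context {R : realType} {d1 d2 : measure_display}.
Context {T1 : measurableType d1} {T2 : measurableType d2}.
Variables (P1 : probability T1 R) (P2 : probability T2 R).

Definition product_prob : probability (T1 * T2)%type R := (P1 \x P2)%E.

Lemma prob_Fubini (F : T1 * T2 -> R) (M : R) :
  measurable_fun setT F -> (forall x, `|F x| <= M) ->
  measurable_fun setT (fun x => \int[P2]_y F (x, y)) /\
  \int[product_prob]_z F z = \int[P1]_x \int[P2]_y F (x, y).
Proof.
move=> mF FM.
have iF := @bounded_integrable _ _ _ product_prob _ _ mF FM.
have sF x : measurable_fun setT (fun y => F (x, y)).
  by apply: measurableT_comp => //; exact: measurable_pair1.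
have FE x : fubini_F P2 (EFin \o F) x = (\int[P2]_y F (x, y))%:E.
  rewrite /fubini_F fineK//.
  by apply: integrable_fin_num => //; exact: (bounded_integrable P2 (sF x)).
split.
  have := measurable_fubini_F iF; rewrite (funext FE).
  by move=> /measurable_EFinP.
rewrite /Rintegral -(integral12_prod_meas1 iF).
by congr fine; apply: eq_integral => x _; exact: FE.
Qed.

End ProductFubini.

Lemma Rintegral_indic_comp {R : realType} {d : measure_display}
  {T : measurableType d} {T' : Type} (m : {measure set T -> \bar R})
  (Y : T -> T') (B : set T') : measurable (Y @^-1` B) ->
  \int[m]_w \1_B (Y w) = fine (m (Y @^-1` B)).
Proof.
by move=> mB; rewrite /Rintegral -[in RHS](setIT (_ @^-1` _)) -integral_indic.
Qed.

Lemma eq_law_Rintegral {R : realType} {d1 d2 d : measure_display}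
  {T1 : measurableType d1} {T2 : measurableType d2} {T : measurableType d}
  (P1 : probability T1 R) (P2 : probability T2 R) (Y1 : T1 -> T) (Y2 : T2 -> T)
  (f : T -> R) (M : R) :
  measurable_fun setT Y1 -> measurable_fun setT Y2 ->
  (forall B, measurable B -> P1 (Y1 @^-1` B) = P2 (Y2 @^-1` B)) ->
  measurable_fun setT f -> (forall x, `|f x| <= M) ->
  \int[P1]_w f (Y1 w) = \int[P2]_w f (Y2 w).
Proof.
move=> mY1 mY2 e mf fM.
have mf' : measurable_fun setT (EFin \o f) by apply/measurable_EFinP.
have i1 := @bounded_integrable _ _ _ P1 _ _ (measurableT_comp mf mY1) (fun x => fM (Y1 x)).
have i2 := @bounded_integrable _ _ _ P2 _ _ (measurableT_comp mf mY2) (fun x => fM (Y2 x)).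
congr fine; have := @integral_pushforward _ _ _ _ _ _ mY1 P1 setT _ mf' i1 measurableT.
rewrite preimage_setT => <-.
have := @integral_pushforward _ _ _ _ _ _ mY2 P2 setT _ mf' i2 measurableT.
rewrite preimage_setT => <-.
by apply: eq_measure_integral => //= B mB _; exact: e.
Qed.

Lemma borel_continuous_map {R : realType} {H : normedModType R} (f : H -> H) :
  continuous f -> measurable_fun setT (f : BorelT H -> BorelT H).
Proof.
move=> /continuousP cf; apply: (@measurability _ _ (BorelT H) (BorelT H) setT f (@open H) erefl).
by move=> _ [B oB <-]; rewrite setTI; apply: sub_sigma_algebra; exact: cf.
Qed.

Section GaussianShift.
Context {R : realType} {H : normedModType R}.
Variable ip : H -> H -> R.
Hypothesis ipP : inner_product ip.
Hypothesis hborel : forall S, sigma_algebra setT S ->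
  (forall g c, S [set y | ip g y <= c]) -> <<s @open H >> `<=` S.
Context {dO : measure_display} {Omega : measurableType dO}.
Variable P : probability Omega R.
Variable xi : Omega -> BorelT H.
Hypothesis mxi : measurable_fun setT xi.
Variable Q : {linear H -> H}.
Hypothesis Qsym : forall f g, ip (Q f) g = ip (Q g) f.
Hypothesis Qge0 : forall f, 0 <= ip (Q f) f.
Hypothesis hG : gaussian0 P ip Q xi.

(** Meant for random vectors built by sums and scalings, whose Borel measurability is not immediate
    while that of their coordinates is; half-spaces generate, so coordinates suffice. *)
Lemma cylinder_measurable {d : measure_display} {T : measurableType d}
  (Y : T -> BorelT H) : (forall g, measurable_fun setT (fun w => ip g (Y w))) ->
  measurable_fun setT Y.
Proof.
move=> mg _ B mB; rewrite setTI.
apply: (hborel (S := [set B | measurable (Y @^-1` B)])) mB.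
  split => //=.
  - by rewrite preimage_set0.
  - by move=> A mA; rewrite setTD preimage_setC; exact: measurableC.
  - by move=> A mA; rewrite preimage_bigcup; exact: bigcup_measurable.
move=> g c /=; have := mg g measurableT `]-oo, c]%classic (measurable_itv _).
by rewrite setTI; congr measurable; apply/seteqP; split => w /=; rewrite in_itv.
Qed.

Let mipxi g : measurable_fun setT (fun w => ip g (xi w)).
Proof.
apply: (@measurableT_comp _ _ _ _ _ _ (ip g : BorelT H -> R)) => //.
by apply: borel_continuous_measurable; exact: ip_continuous.
Qed.

Let cos1 (x : R) : `|cos x| <= 1.
Proof. by rewrite ler_norml cos_geN1 cos_le1. Qed.

Let mcos : measurable_fun setT (@cos R).
Proof. by apply: continuous_measurable_fun; exact: continuous_cos. Qed.

Let msin : measurable_fun setT (@sin R).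
Proof. by apply: continuous_measurable_fun; exact: continuous_sin. Qed.

Let gaussian_cos g c :
  \int[P]_w cos (ip g (xi w) + c) = expR (- (ip (Q g) g / 2)) * cos c.
Proof.
under eq_Rintegral do rewrite cosD.
have ic : P.-integrable setT (EFin \o (fun w => cos (ip g (xi w)))).
  by apply: (@bounded_integrable _ _ _ P _ 1) => //; exact: measurableT_comp.
have isn : P.-integrable setT (EFin \o (fun w => sin (ip g (xi w)))).
  apply: (@bounded_integrable _ _ _ P _ 1); first exact: measurableT_comp.
  by move=> x; rewrite ler_norml sin_geN1 sin_le1.
rewrite RintegralB//; last 2 first.
- by have := integrableZr measurableT (cos c) ic; apply: eq_integrable.
- by have := integrableZr measurableT (sin c) isn; apply: eq_integrable.
rewrite !RintegralZr//.
by have [-> ->] := hG g; rewrite mul0r subr0.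
Qed.

Let degenerate h : ip (Q h) h = 0 -> Q h = 0.
Proof.
move=> h0; apply/eqP; rewrite -normr_eq0 -sqrf_eq0 -(ipxx ipP).
set b := ip _ _; have b0 : 0 <= b by rewrite /b (ipxx ipP) sqr_ge0.
rewrite eq_le b0 andbT leNgt; apply/negP => bp.
(* Since [<Q h, h> = 0], the form at [t h - Q h] is affine in [t] with slope [- 2 b]; this [t] gives
   it the value -1. *)
pose t := (ip (Q (Q h)) (Q h) + 1) / (2 * b).
have := Qge0 (t *: h - Q h).
rewrite linearB linearZ/= !(ipBl ipP) !(ipBr ipP) !(ipZl ipP) !(ipZr ipP).
rewrite (Qsym (Q h) h) h0 -/b.
have tb : 2 * (t * b) = ip (Q (Q h)) (Q h) + 1 by rewrite /t; field; rewrite gt_eqF.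
by move: tb; lra.
Qed.

(* Conditioning on [<h, xi>]: [xi] has the law of [xi - <h, xi> v / r + z v]
   with [z] an independent standard Gaussian, so that translating by [Q h = r v]
   amounts to translating [z] by [r]. *)
Lemma gaussian_translation (phi : BorelT H -> R) h :
  measurable_fun setT phi -> (forall y, `|phi y| <= 1) ->
  `|\int[P]_w phi (Q h + xi w) - \int[P]_w phi (xi w)| <=
    2 * (1 - expR (- (@gauss_abs_moment R * Num.sqrt (ip (Q h) h) + ip (Q h) h / 2))).
Proof.
move=> mphi phi1; set a := ip (Q h) h.
have [a0|a_neq0] := eqVneq a 0.
  rewrite (degenerate a0); under eq_Rintegral do rewrite add0r.
  by rewrite subrr normr0 a0 sqrtr0 mulr0 mul0r addr0 oppr0 expR0 subrr mulr0.
have a_gt0 : 0 < a by rewrite lt_def a_neq0 Qge0.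
pose r := Num.sqrt a; have r0 : 0 < r by rewrite sqrtr_gt0.
have rr : r * r = a by rewrite -expr2 sqr_sqrtr// ltW.
pose v := r^-1 *: Q h.
(* The variable [<h, xi> / r] is standard Gaussian and its regression direction is [v]: this
   component is removed from [xi] and replaced by the fresh coordinate. *)
pose Y (x : Omega * R) : BorelT H :=
  xi x.1 - (r^-1 * ip h (xi x.1)) *: v + x.2 *: v.
have ipY g x : ip g (Y x) =
    ip (g - (r^-1 * ip g v) *: h) (xi x.1) + x.2 * ip g v.
  rewrite /Y (ipDr ipP) (ipBr ipP) !(ipZr ipP) (ipBl ipP) (ipZl ipP).
  by ring.
have mY : measurable_fun setT Y.
  apply: cylinder_measurable => g; under eq_fun do rewrite ipY.
  apply: measurable_funD.
    exact: (measurableT_comp (mipxi _) measurable_fst).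
  by apply: measurable_funM => //; exact: measurable_snd.
pose G : probability (measurableTypeR R) R := normal_prob (0 : R) 1.
have charY g c : \int[P]_w cos (ip g (xi w) + c) =
    \int[(product_prob P G)]_x cos (ip g (Y x) + c).
  set g' := g - (r^-1 * ip g v) *: h; set be := ip g v.
  have mF : measurable_fun setT (fun x => cos (ip g (Y x) + c)).
    apply: measurableT_comp => //; apply: measurable_funD => //.
    apply: (@measurableT_comp _ _ _ _ _ _ (ip g : BorelT H -> R)) => //.
    by apply: borel_continuous_measurable; exact: ip_continuous.
  have [_ ->] := prob_Fubini P G mF (fun x => cos1 _).
  have inner w : \int[G]_z cos (ip g (Y (w, z)) + c) =
      expR (- (be ^+ 2 / 2)) * cos (ip g' (xi w) + c).
    rewrite -normal_char_fun; apply: eq_Rintegral => z _.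
    by rewrite ipY/= -/be -/g'; congr cos; ring.
  under [RHS]eq_Rintegral do rewrite inner.
  rewrite RintegralZl//; last first.
    apply: (@bounded_integrable _ _ _ P _ 1) => //.
    by apply: measurableT_comp => //; exact: measurable_funD.
  rewrite !gaussian_cos mulrA -expRD; congr (expR _ * _).
  have Qhg : ip (Q h) g = r * be.
    by rewrite /be /v (ipZr ipP) (ipC ipP g) mulrA mulfV ?gt_eqF// mul1r.
  (* The variance lost by removing the component is the one that the independent coordinate brings
     back. *)
  have -> : ip (Q g') g' = ip (Q g) g - be ^+ 2.
    rewrite /g' -/be linearB linearZ/= !(ipBl ipP) !(ipBr ipP).
    rewrite !(ipZl ipP) !(ipZr ipP) (Qsym g h) Qhg -/a -rr.
    by field; rewrite gt_eqF.
  by field.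
have law B : measurable B -> P (xi @^-1` B) = (product_prob P G) (Y @^-1` B).
  move=> mB; have tB := trig_borel ipP hborel mB.
  have [_] := trig_closure_eq ipP (P2 := product_prob P G) mxi mY charY tB.
  have mx : measurable (xi @^-1` B) by rewrite -[X in measurable X]setTI; exact: mxi.
  have my : measurable (Y @^-1` B) by rewrite -[X in measurable X]setTI; exact: mY.
  rewrite !Rintegral_indic_comp//.
  by move=> e; rewrite -[LHS]fineK ?fin_num_measure// -[RHS]fineK ?fin_num_measure// e.
have shY w z : Q h + Y (w, z) = Y (w, z + r).
  rewrite /Y/= scalerDl addrCA; congr (_ + _).
  by rewrite addrC; congr (_ + _); rewrite /v scalerA mulfV ?gt_eqF// scale1r.
have mphis : measurable_fun setT (fun y : BorelT H => phi (Q h + y)).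
  apply: (measurableT_comp mphi); apply: borel_continuous_map => y.
  by apply: cvgD; [exact: cvg_cst|exact: cvg_id].
rewrite (eq_law_Rintegral (P2 := product_prob P G) mxi mY law mphi phi1).
rewrite (eq_law_Rintegral (P2 := product_prob P G) mxi mY law mphis (fun y => phi1 _)).
have mphiY := measurableT_comp mphi mY.
have mphisY := measurableT_comp mphis mY.
have [m1 ->] := prob_Fubini P G mphiY (fun x => phi1 _).
have [m2 ->] := prob_Fubini P G mphisY (fun x => phi1 _).
rewrite -RintegralB//; last 2 first.
- apply: (@bounded_integrable _ _ _ P _ 1 m2) => w.
  apply: norm_prob_Rintegral => [|z]; last exact: phi1.
  by apply: (measurableT_comp mphisY); exact: measurable_pair1.
- apply: (@bounded_integrable _ _ _ P _ 1 m1) => w.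
  apply: norm_prob_Rintegral => [|z]; last exact: phi1.
  by apply: (measurableT_comp mphiY); exact: measurable_pair1.
apply: norm_prob_Rintegral; first exact: measurable_funB.
move=> w /=; under [X in `|X - _|]eq_Rintegral do rewrite shY.
have mw : measurable_fun setT (fun z => phi (Y (w, z))).
  by apply: (measurableT_comp mphiY); exact: measurable_pair1.
have := gaussian_shift_overlap r mw (fun z => phi1 _).
have r2 : r ^+ 2 = a by rewrite expr2.
by rewrite (gtr0_norm r0) r2.
Qed.

End GaussianShift.

(** * Functionals on bounded measurable functions *)

(** With [e t] the tail of the geometric series, the intervals [[u t - e t, u t + e t]] are nested;
    the supremum of their left ends lies in all of them, which gives the limit together with its
    rate. *)
Lemma geometric_limit {R : realType} (u : nat -> R) (a C : R) :
  0 <= a < 1 -> 0 <= C -> (forall t, `|u t.+1 - u t| <= C * a ^+ t) ->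
  exists l, forall t, `|u t - l| <= C * a ^+ t / (1 - a).
Proof.
move=> /andP[a0 a1] C0 hu; have d0 : 0 < 1 - a by rewrite subr_gt0.
pose e t := C * a ^+ t / (1 - a).
have e0 t : 0 <= e t by rewrite /e divr_ge0 ?mulr_ge0 ?exprn_ge0// ltW.
have eS t : e t - e t.+1 = C * a ^+ t.
  by rewrite /e exprS; field; rewrite gt_eqF.
have up t : u t - e t <= u t.+1 - e t.+1.
  by have := hu t; rewrite ler_norml => /andP[]; have := eS t; lra.
have dn t : u t.+1 + e t.+1 <= u t + e t.
  by have := hu t; rewrite ler_norml => /andP[]; have := eS t; lra.
have upS t s : u t - e t <= u (s + t)%N - e (s + t)%N.
  by elim: s => // s IH; rewrite addSn (le_trans IH).
have dnS t s : u (s + t)%N + e (s + t)%N <= u t + e t.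
  by elim: s => // s IH; rewrite addSn (le_trans _ IH).
pose W : set R := range (fun t => u t - e t).
have ub t : ubound W (u t + e t).
  move=> _ [s _ <-]; have := upS s t; have := dnS t s.
  by rewrite addnC; have := e0 (t + s)%N; lra.
have hW : has_sup W.
  by split; [exists (u 0%N - e 0%N), 0%N|exists (u 0%N + e 0%N); exact: ub].
exists (sup W) => t; rewrite -/(e t).
have h1 : u t - e t <= sup W by apply: sup_upper_bound => //; exists t.
have h2 : sup W <= u t + e t := ge_sup hW.1 (ub t).
by rewrite ler_norml; apply/andP; split; move: h1 h2; lra.
Qed.

Section BoundedMeasurable.
Context {R : realType} {d : measure_display} {T : measurableType d}.

Definition bounded_measurable (f : T -> R) : Prop :=
  measurable_fun setT f /\ exists M, forall x, `|f x| <= M.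

Lemma bm_cst c : bounded_measurable (fun=> c).
Proof. by split; [exact: measurable_cst|exists `|c|]. Qed.

Lemma bm_add f g : bounded_measurable f -> bounded_measurable g ->
  bounded_measurable (fun x => f x + g x).
Proof.
move=> [mf [M fM]] [mg [N gN]]; split; first exact: measurable_funD.
by exists (M + N) => x; rewrite (le_trans (ler_normD _ _))// lerD.
Qed.

Lemma bm_scale a f : bounded_measurable f -> bounded_measurable (fun x => a * f x).
Proof.
move=> [mf [M fM]]; split; first exact: measurable_funM.
by exists (`|a| * M) => x; rewrite normrM ler_wpM2l.
Qed.

Lemma bm_indic B : measurable B -> bounded_measurable (\1_B).
Proof.
move=> mB; split; first exact: measurable_indic.
by exists 1 => x; rewrite indicE; case: (_ \in _); rewrite ?normr0 ?normr1.
Qed.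

(** What integration against a probability, the ergodic mean and the integral of [step f] have in
    common. It is just enough for agreement on indicators to extend to all bounded measurable
    functions. *)
Record bounded_functional (I : (T -> R) -> R) : Prop := BoundedFunctional {
  bf_add : forall f g, bounded_measurable f -> bounded_measurable g ->
    I (fun x => f x + g x) = I f + I g;
  bf_scale : forall a f, bounded_measurable f -> I (fun x => a * f x) = a * I f;
  bf_cvg : forall (f_ : nat -> T -> R) f M, (forall n, measurable_fun setT (f_ n)) ->
    (forall n x, `|f_ n x| <= M) -> (forall x, f_ n x @[n --> \oo] --> f x) ->
    I (f_ n) @[n --> \oo] --> I f }.

Lemma bf_Rintegral (m : probability T R) :
  bounded_functional (fun f => \int[m]_x f x).
Proof.
split.
- move=> f g [mf [M fM]] [mg [N gN]]; rewrite RintegralD//.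
    exact: bounded_integrable mf fM.
  exact: bounded_integrable mg gN.
- by move=> a f [mf [M fM]]; rewrite RintegralZl//; exact: bounded_integrable mf fM.
- by move=> f_ f M mf fM ff; exact: bounded_Rintegral_cvg mf fM ff.
Qed.

(** For [u >= 0] this is the integer part of [u] capped at [N], written as a sum of indicators. *)
Let levels (N : nat) (u : R) : R := \sum_(k < N) (k.+1%:R <= u)%R%:R.

Let levels_full N u : N%:R <= u -> levels N u = N%:R.
Proof.
elim: N => [|N IH] Nu; rewrite /levels ?big_ord0// big_ord_recr/= Nu.
by rewrite -/(levels N u) IH ?natr1// (le_trans _ Nu)// ler_nat.
Qed.

Let levels_approx N u : 0 <= u -> u <= N%:R -> levels N u <= u <= levels N u + 1.
Proof.
move=> u0; suff [h1 h2] : levels N u <= u /\ (u <= N%:R -> u <= levels N u + 1).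
  by move=> /h2 ->; rewrite h1.
elim: N => [|N [IH1 IH2]].
  by rewrite /levels big_ord0 add0r; split=> // h; rewrite (le_trans h).
have [Nu|Nu] := lerP N.+1%:R u.
  by rewrite levels_full//; split=> // h; rewrite (le_trans h)// lerDl.
have -> : levels N.+1 u = levels N u.
  by rewrite /levels big_ord_recr/= leNgt Nu addr0.
split=> // _; have [uN|uN] := lerP u N%:R; first exact: IH2.
by rewrite (levels_full (ltW uN)) natr1 ltW.
Qed.

(** A function with values in [[0, 1]] is within [1 / (N + 1)] of a sum of indicators of its level
    sets; an affine change of variable reduces the general case to this one. *)
Lemma bounded_functional_ext (I J : (T -> R) -> R) :
  bounded_functional I -> bounded_functional J ->
  (forall B, measurable B -> I (\1_B) = J (\1_B)) ->
  forall f, bounded_measurable f -> I f = J f.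
Proof.
move=> bI bJ IJ; pose ap (N : nat) (f : T -> R) (x : T) : R := N.+1%:R^-1 *
    \sum_(k < N.+1) (\1_[set y | k.+1%:R <= N.+1%:R * f y] x : R).
have mset (N : nat) (f : T -> R) (k : nat) : measurable_fun setT f ->
    measurable [set y | k.+1%:R <= N.+1%:R * f y].
  move=> mf; have mg : measurable_fun setT (fun y => N.+1%:R * f y).
    exact: measurable_funM.
  have := mg measurableT `[k.+1%:R, +oo[%classic (measurable_itv _).
  by rewrite setTI; congr measurable; apply/seteqP; split=> y /=; rewrite in_itv/= andbT.
have sums (N : nat) (f : T -> R) : measurable_fun setT f -> forall n,
    bounded_measurable (fun x => \sum_(k < n) (\1_[set y | k.+1%:R <= N.+1%:R * f y] x : R))
    /\ I (fun x => \sum_(k < n) (\1_[set y | k.+1%:R <= N.+1%:R * f y] x : R)) =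
       J (fun x => \sum_(k < n) (\1_[set y | k.+1%:R <= N.+1%:R * f y] x : R)).
  move=> mf; elim=> [|n [IH1 IH2]].
    (* The empty sum is written as a multiple by 0 so that homogeneity gives the value 0 for both
       functionals. *)
    rewrite (_ : (fun x => _) = fun x => 0 * (cst 0 x)); last first.
      by apply/funext => x; rewrite big_ord0 mul0r.
    split; first by apply: bm_scale; exact: bm_cst.
    rewrite (bf_scale bI 0 (bm_cst 0)) (bf_scale bJ 0 (bm_cst 0)).
    by rewrite !mul0r.
  have bi := bm_indic (mset N f n mf).
  rewrite (_ : (fun x => _) = fun x => \sum_(k < n)
      (\1_[set y | k.+1%:R <= N.+1%:R * f y] x : R) +
      \1_[set y | n.+1%:R <= N.+1%:R * f y] x); last first.
    by apply/funext => x; rewrite big_ord_recr.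
  split; first exact: bm_add.
  by rewrite (bf_add bI)// (bf_add bJ)// IH2 IJ//; exact: mset.
have unit (f : T -> R) : measurable_fun setT f -> (forall x, 0 <= f x <= 1) -> I f = J f.
  move=> mf f01.
  have apx N x : ap N f x <= f x <= ap N f x + N.+1%:R^-1.
    have N0 : (0 : R) < N.+1%:R by [].
    have /andP[f0 f1] := f01 x.
    have -> : ap N f x = N.+1%:R^-1 * levels N.+1 (N.+1%:R * f x).
      congr (_ * _); apply: eq_bigr => k _; rewrite indicE; congr (_%:R).
      by congr nat_of_bool; apply/idP/idP; rewrite inE.
    have /andP[h1 h2] : levels N.+1 (N.+1%:R * f x) <= N.+1%:R * f x <=
        levels N.+1 (N.+1%:R * f x) + 1.
      apply: levels_approx; first by rewrite mulr_ge0// ltW.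
      by rewrite ler_piMr// ltW.
    apply/andP; split; first by rewrite ler_pdivrMl.
    by rewrite -[X in _ + X]mulr1 -mulrDr ler_pdivlMl.
  have mN N : bounded_measurable (ap N f).
    by apply: bm_scale; have [] := sums N f mf N.+1.
  have apb N x : `|ap N f x| <= 1.
    have /andP[h1 h2] := apx N x; have /andP[f0 f1] := f01 x.
    rewrite ger0_norm ?(le_trans h1)//.
    by rewrite /ap mulr_ge0// sumr_ge0// => k _; rewrite indicE.
  have apc x : ap N f x @[N --> \oo] --> f x.
    apply: (@squeeze_cvgr _ _ _ _ (fun N => f x - harmonic N) (cst (f x))).
    - apply: nearW => N; have /andP[h1 h2] := apx N x.
      by rewrite /harmonic/= h1 andbT lerBlDr.
    - rewrite -[X in _ --> X](subr0 (f x)); apply: cvgB; first exact: cvg_cst.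
      exact: cvg_harmonic.
    - exact: cvg_cst.
  have cI := bf_cvg bI (fun N => (mN N).1) apb apc.
  have cJ := bf_cvg bJ (fun N => (mN N).1) apb apc.
  have e : (fun N => I (ap N f)) = (fun N => J (ap N f)).
    apply/funext => N; have [b e] := sums N f mf N.+1.
    by rewrite /ap (bf_scale bI)// (bf_scale bJ)// e.
  by rewrite -(cvg_lim (@Rhausdorff R) cI) -(cvg_lim (@Rhausdorff R) cJ) e.
move=> f [mf [M fM]].
pose m := `|M| + 1; have m0 : 0 < m by rewrite ltr_wpDl.
pose g x := (2 * m)^-1 * (f x + m).
have bf1 : bounded_measurable (fun x => f x + m).
  by apply: bm_add; [split => //; exists M|exact: bm_cst].
have bg : bounded_measurable g by exact: bm_scale.
have g01 x : 0 <= g x <= 1.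
  have := le_trans (fM x) (ler_norm M); rewrite ler_norml => /andP[h1 h2].
  rewrite /g mulr_ge0 ?invr_ge0 ?mulr_ge0 ?(ltW m0)//=.
    by rewrite mulrC ler_pdivrMr ?mulr_gt0// mul1r /m; move: h2; lra.
  by rewrite /m; move: h1; lra.
have -> : f = fun x => 2 * m * g x + - m * cst 1 x.
  by apply/funext => x; rewrite /g /=; field; rewrite gt_eqF.
have b1 : bounded_measurable (fun x => 2 * m * g x) by exact: bm_scale.
have b2 : bounded_measurable (fun x => - m * cst 1 x) by apply: bm_scale; exact: bm_cst.
rewrite (bf_add bI)// (bf_add bJ)// (bf_scale bI)// (bf_scale bJ)// unit//; last exact: bg.1.
rewrite (bf_scale bI _ (bm_cst 1)) (bf_scale bJ _ (bm_cst 1)); congr (_ + _ * _).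
by apply: unit => // x; rewrite /= ler01 lexx.
Qed.

End BoundedMeasurable.

(** * Harris' theorem *)

Section Harris.
Context {R : realType} {dT dO : measure_display}.
Context {T : measurableType dT} {Omega : measurableType dO}.
Variables (P : probability Omega R) (F : T -> Omega -> T).
Hypothesis mF : forall x, measurable_fun setT (F x).
Local Notation bm := (@bounded_measurable R _ T).

Definition step (phi : T -> R) : T -> R := fun x => \int[P]_w phi (F x w).

Hypothesis mstep : forall phi : T -> R, measurable_fun setT phi ->
  (forall z, `|phi z| <= 1) -> measurable_fun setT (step phi).

Variables (V : T -> R) (rho K0 : R).
Hypothesis V_ge0 : forall x, 0 <= V x.
Hypothesis rho01 : 0 <= rho < 1.
Hypothesis K0_gt0 : 0 < K0.
Hypothesis iV : forall x, P.-integrable setT (EFin \o (fun w => V (F x w))).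
Hypothesis drift : forall x, \int[P]_w V (F x w) <= rho * V x + K0.
Hypothesis overlap : forall r, exists2 delta, 0 < delta <= 1 &
  forall (x y : T) (phi : T -> R), measurable_fun setT phi -> (forall z, `|phi z| <= 1) ->
    V x + V y <= r -> `|step phi x - step phi y| <= 2 * (1 - delta).

Let comp_bm f x : bm f -> P.-integrable setT (EFin \o (fun w => f (F x w))).
Proof.
move=> [mf [M fM]]; apply: (@bounded_integrable _ _ _ P _ M) => //.
exact: measurableT_comp mf (mF x).
Qed.

Let step_add f g x : bm f -> bm g ->
  step (fun z => f z + g z) x = step f x + step g x.
Proof. by move=> bf bg; rewrite /step RintegralD//; exact: comp_bm. Qed.

Let step_scale a f x : bm f -> step (fun z => a * f z) x = a * step f x.
Proof. by move=> bf; rewrite /step RintegralZl//; exact: comp_bm. Qed.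

Let step_cst c x : step (fun=> c) x = c.
Proof. exact: Rintegral_prob_cst. Qed.

Let step_bound (f : T -> R) M x : measurable_fun setT f -> (forall z, `|f z| <= M) ->
  `|step f x| <= M.
Proof.
move=> mf fM; apply: norm_prob_Rintegral; last by move=> w; exact: fM.
exact: measurableT_comp mf (mF x).
Qed.

Let step_bm f : bm f -> bm (step f).
Proof.
move=> bf; have [mf [M fM]] := bf; split; last first.
  by exists M => x; exact: step_bound.
pose m := `|M| + 1; have m0 : 0 < m by rewrite ltr_wpDl.
have h : measurable_fun setT (step (fun z => m^-1 * f z)).
  apply: mstep => [|z]; first exact: measurable_funM.
  rewrite normrM gtr0_norm ?invr_gt0// mulrC ler_pdivrMr// mul1r.
  by rewrite (le_trans (fM z))// (le_trans (ler_norm M))// lerDl.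
have -> : step f = fun x => m * step (fun z => m^-1 * f z) x.
  by apply/funext => x; rewrite step_scale// mulrA mulfV ?mul1r// gt_eqF.
exact: measurable_funM.
Qed.

Let iter_bm n f : bm f -> bm (iter n step f).
Proof. by move=> bf; elim: n => //= n; exact: step_bm. Qed.

Let iter_bound n f M : bm f -> (forall z, `|f z| <= M) ->
  forall x, `|iter n step f x| <= M.
Proof.
move=> bf fM; elim: n => //= n IH x.
by apply: step_bound => //; have [] := iter_bm n bf.
Qed.

(* Centring [phi] so that [|phi| <= 1 + b V] and cutting it at level [1], the
   overlap handles the bounded part and the drift the remainder (Hairer and
   Mattingly). *)
Lemma harris_contraction : exists alpha b : R, [/\ 0 < alpha < 1, 0 < b &
  forall phi, bm phi -> (forall x y, `|phi x - phi y| <= 2 + b * (V x + V y)) ->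
  forall x y, `|step phi x - step phi y| <= alpha * (2 + b * (V x + V y))].
Proof.
have /andP[rho0 rho1] := rho01.
(* When [V x + V y >= r], the constant [2 K0] is at most half of [(1 - rho) (V x + V y)], so the
   drift still contracts at the midpoint rate [rho']. *)
pose r := 4 * K0 / (1 - rho).
have d0 : 0 < 1 - rho by rewrite subr_gt0.
have r0 : 0 < r by rewrite divr_gt0// mulr_gt0.
have [delta /andP[de0 de1] hov] := overlap r.
(* When [V x + V y < r], the drift constants cost [2 b K0 = delta], half of the gain [2 delta] given
   by the overlap. *)
pose b := delta / (2 * K0); have b0 : 0 < b by rewrite divr_gt0// mulr_gt0.
pose rho' := (1 + rho) / 2.
(* The ratio [(2 + b rho' S) / (2 + b S)] decreases in [S], so its worst value over [S >= r] is at
   [r]. *)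
pose al1 := (2 + b * rho' * r) / (2 + b * r).
have br0 : 0 < b * r by rewrite mulr_gt0.
have bK : b * (2 * K0) = delta by rewrite /b; field; rewrite gt_eqF.
have rK : r * (1 - rho) = 4 * K0 by rewrite /r; field; rewrite gt_eqF.
have rho'1 : rho' < 1 by rewrite /rho'; lra.
have rho'0 : 0 < rho' by rewrite /rho'; lra.
have al1_lt1 : al1 < 1.
  rewrite /al1 ltr_pdivrMr ?mul1r; last by lra.
  have : b * r * rho' < b * r by rewrite gtr_pMr.
  by lra.
pose alpha := Num.max al1 (Num.max (1 - delta / 2) rho').
have a1 : al1 <= alpha by rewrite /alpha le_max lexx.
have a2 : 1 - delta / 2 <= alpha by rewrite /alpha !le_max lexx orbT.
have a3 : rho' <= alpha by rewrite /alpha !le_max lexx !orbT.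
have alt1 : alpha < 1 by rewrite /alpha !gt_max al1_lt1 rho'1 /= andbT; lra.
exists alpha, b; split=> //; first by rewrite alt1 andbT (lt_le_trans rho'0).
move=> phi bphi osc x y; have [mphi [M phiM]] := bphi.
(* The oscillation bound says that every [phi z' - (1 + b V z')] lies below every
   [phi z + (1 + b V z)]; any number in between, here the supremum of the former, is a centre. *)
pose W : set R := range (fun z => phi z - (1 + b * V z)).
have ub z : ubound W (phi z + (1 + b * V z)).
  move=> _ [z' _ <-]; have := osc z' z; rewrite ler_norml => /andP[_].
  by rewrite mulrDr; lra.
have W0 : W !=set0 by exists (phi x - (1 + b * V x)), x.
pose c := sup W.
have cen z : `|phi z - c| <= 1 + b * V z.
  have h1 : phi z - (1 + b * V z) <= c.
    by apply: sup_upper_bound; [split => //; exists (phi x + (1 + b * V x))|exists z].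
  have h2 : c <= phi z + (1 + b * V z) := ge_sup W0 (ub z).
  by rewrite ler_norml; apply/andP; split; move: h1 h2; lra.
pose psi z := phi z - c.
have bpsi : bm psi by apply: bm_add => //; exact: bm_cst.
have [mpsi [N psiN]] := bpsi.
have stepc z : step phi z = step psi z + c.
  by rewrite /psi step_add ?step_cst ?subrK//; exact: bm_cst.
have -> : step phi x - step phi y = step psi x - step psi y.
  by rewrite !stepc opprD addrACA subrr addr0.
have iVb z : P.-integrable setT (EFin \o (fun w => b * V (F z w))).
  by have := integrableZl measurableT b (iV z); apply: eq_integrable.
have drb z : \int[P]_w (b * V (F z w)) <= b * (rho * V z + K0).
  by rewrite RintegralZl// ler_pM2l.
have S0 : 0 <= V x + V y by rewrite addr_ge0.
have [rS|Sr] := lerP r (V x + V y).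
  have far z : `|step psi z| <= 1 + b * (rho * V z + K0).
    rewrite (le_trans (le_normr_Rintegral measurableT (comp_bm z bpsi)))//.
    apply: (@le_trans _ _ (\int[P]_w (1 + b * V (F z w)))).
      apply: le_Rintegral => //.
      - by have := integrable_abse (comp_bm z bpsi); apply: eq_integrable.
      - have i1 : P.-integrable setT (EFin \o (fun _ : Omega => 1 : R)).
          by apply: (@bounded_integrable _ _ _ P _ 1) => // w; rewrite normr1.
        by have := integrableD measurableT i1 (iVb z); apply: eq_integrable.
      - by move=> w _; exact: cen.
    rewrite RintegralD//; first by rewrite Rintegral_prob_cst lerD2l.
    by apply: (@bounded_integrable _ _ _ P _ 1) => // w; rewrite normr1.
  rewrite (le_trans (ler_normB _ _))//.
  apply: (@le_trans _ _ (2 + b * rho' * (V x + V y))).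
    have h : rho * (V x + V y) + 2 * K0 <= rho' * (V x + V y).
      have : r * (1 - rho) <= (V x + V y) * (1 - rho) by rewrite ler_pM2r.
      by rewrite rK /rho'; lra.
    have : b * (rho * (V x + V y) + 2 * K0) <= b * (rho' * (V x + V y)).
      by rewrite ler_pM2l.
    by have := far x; have := far y; rewrite !mulrDr mulrA; lra.
  have q : 0 < 2 + b * (V x + V y) by rewrite ltr_wpDr// mulr_ge0// ltW.
  apply: (@le_trans _ _ (al1 * (2 + b * (V x + V y)))); last by rewrite ler_pM2r.
  have q' : 0 < 2 + b * r by lra.
  rewrite /al1 [leRHS]mulrAC ler_pdivlMr//.
  have : 0 <= b * ((1 - rho') * (V x + V y - r)).
    by rewrite mulr_ge0 ?(ltW b0)// mulr_ge0 ?subr_ge0// ltW.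
  set S := V x + V y; nra.
pose psi1 z := Num.max (- 1) (Num.min 1 (psi z)).
have m1 : measurable_fun setT psi1.
  by apply: measurable_maxr => //; exact: measurable_minr.
have p1 z : `|psi1 z| <= 1.
  rewrite ler_norml /psi1 le_max lexx/= ge_max ge_min lexx/= andbT.
  by lra.
(* Zero where [|psi| <= 1] and of size [|psi| - 1] elsewhere, hence at most [b V]. The form with
   [-1] fits the additivity and homogeneity of [step]. *)
pose psi2 z := psi z + -1 * psi1 z.
have b1 : bm psi1 by split=> //; exists 1.
have b2 : bm psi2 by apply: bm_add => //; exact: bm_scale.
have p2 z : `|psi2 z| <= b * V z.
  have bV : 0 <= b * V z by rewrite mulr_ge0// ltW.
  have := cen z; rewrite -/(psi z) /psi2 /psi1 !ler_norml => /andP[h1 h2].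
  by case: (ltP 1 (psi z)) => h3; case: (ltP (- 1)) => h4; apply/andP; split;
    move: h1 h2 h3 h4 bV; lra.
have s12 z : step psi z = step psi1 z + step psi2 z.
  by rewrite (step_add z bpsi (bm_scale (-1) b1)) (step_scale _ _ b1); ring.
have near2 z : `|step psi2 z| <= b * (rho * V z + K0).
  rewrite (le_trans (le_normr_Rintegral measurableT (comp_bm z b2)))//.
  rewrite (le_trans _ (drb z))//; apply: le_Rintegral => //.
  by have := integrable_abse (comp_bm z b2); apply: eq_integrable.
have ov := hov x y psi1 m1 p1 (ltW Sr).
apply: (@le_trans _ _ (2 - delta + b * rho * (V x + V y))).
  rewrite !s12 opprD addrACA (le_trans (ler_normD _ _))//.
  have := ler_normB (step psi2 x) (step psi2 y).
  have := near2 x; have := near2 y; rewrite !mulrDr.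
  move: ov bK; set A := `|step psi1 x - step psi1 y|.
  by lra.
have bS : 0 <= b * (V x + V y) by rewrite mulr_ge0// ltW.
have : rho * (b * (V x + V y)) <= alpha * (b * (V x + V y)).
  by rewrite ler_wpM2r// (le_trans _ a3)// /rho'; lra.
by set S := V x + V y; rewrite [alpha * (2 + _)]mulrDr; move: a2; lra.
Qed.

Let x0 : T := point.

(** Applying the contraction to the iterates divided by [al ^+ t] makes their weighted oscillations
    decay geometrically. An increment at [x0] is the mean of such an oscillation between [F x0 w]
    and [x0], so the increments are summable. *)
Lemma harris_convergence : exists (gamma C : R), [/\ 0 < gamma < 1, 0 < C &
  forall phi : T -> R, measurable_fun setT phi -> (forall z, `|phi z| <= 1) ->
  exists l, forall t x, `|iter t step phi x - l| <= C * gamma ^+ t * (1 + V x)].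
Proof.
have [al [b [/andP[al0 al1] b0 contr]]] := harris_contraction.
have d0 : 0 < 1 - al by rewrite subr_gt0.
have /andP[rho0 rho1] := rho01.
(* Bounds the mean of [2 + b (V (F x0 w) + V x0)] by the drift. In [C] below, [B / (1 - al)] is the
   geometric tail at [x0] and the rest is the oscillation between [x] and [x0]. *)
pose B := 2 + b * (V x0 + (rho * V x0 + K0)).
have B0 : 0 <= B by rewrite addr_ge0// mulr_ge0 ?(ltW b0)// !addr_ge0 ?mulr_ge0// ltW.
pose C := 2 + b * V x0 + b + B / (1 - al).
have C0 : 0 < C.
  by rewrite /C ltr_wpDr ?divr_ge0 ?(ltW d0)// ltr_wpDl// addr_ge0// mulr_ge0// ltW.
exists al, C; split=> //; first by rewrite al0.
move=> phi mphi phi1; have bphi : bm phi by split=> //; exists 1.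
have osc t x y : `|iter t step phi x - iter t step phi y| <=
    al ^+ t * (2 + b * (V x + V y)).
  elim: t x y => [|t IH] x y.
    rewrite expr0 mul1r /= (le_trans (ler_normB _ _))// (le_trans (lerD (phi1 x) (phi1 y)))//.
    by rewrite lerDl mulr_ge0 ?(ltW b0)// addr_ge0.
  have at0 : 0 < al ^+ t by rewrite exprn_gt0.
  pose g z := (al ^+ t)^-1 * iter t step phi z.
  have bg : bm g by apply: bm_scale; exact: iter_bm.
  have := contr g bg.
  have sg z : step g z = (al ^+ t)^-1 * iter t.+1 step phi z.
    by rewrite /g step_scale//; exact: iter_bm.
  move=> /(_ _ x y); rewrite !sg -mulrBr normrM gtr0_norm ?invr_gt0//.
  rewrite ler_pdivrMl// mulrA -exprSr; apply => u v.
  by rewrite /g -mulrBr normrM gtr0_norm ?invr_gt0// ler_pdivrMl.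
have incr t : `|iter t.+1 step phi x0 - iter t step phi x0| <= B * al ^+ t.
  have bt := iter_bm t bphi; have [mt _] := bt.
  have bt' : bm (fun z => iter t step phi z + - iter t step phi x0).
    by apply: bm_add => //; exact: bm_cst.
  have -> : iter t.+1 step phi x0 - iter t step phi x0 =
      step (fun z => iter t step phi z + - iter t step phi x0) x0.
    by rewrite step_add ?step_cst//; exact: bm_cst.
  rewrite (le_trans (le_normr_Rintegral measurableT (comp_bm x0 bt')))//.
  have iVb : P.-integrable setT (EFin \o (fun w => al ^+ t * b * V (F x0 w))).
    by have := integrableZl measurableT (al ^+ t * b) (iV x0); apply: eq_integrable.
  pose c := al ^+ t * (2 + b * V x0).
  have ic : P.-integrable setT (EFin \o (fun _ : Omega => c)).
    by apply: (@bounded_integrable _ _ _ P _ `|c|).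
  apply: (@le_trans _ _ (\int[P]_w (c + al ^+ t * b * V (F x0 w)))).
    apply: le_Rintegral => //.
    - by have := integrable_abse (comp_bm x0 bt'); apply: eq_integrable.
    - by have := integrableD measurableT ic iVb; apply: eq_integrable.
    - move=> w _; apply: (le_trans (osc t (F x0 w) x0)).
      by rewrite /c le_eqVlt; apply/orP; left; apply/eqP; ring.
  rewrite RintegralD// Rintegral_prob_cst RintegralZl//.
  have : al ^+ t * b * \int[P]_w V (F x0 w) <= al ^+ t * b * (rho * V x0 + K0).
    by rewrite ler_wpM2l// mulr_ge0 ?exprn_ge0// ltW.
  by rewrite /c /B; lra.
have [l hl] := geometric_limit (u := fun t => iter t step phi x0) (a := al)
  (C := B) ltac:(by rewrite (ltW al0)) B0 incr.
exists l => t x.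
rewrite -(subrK (iter t step phi x0) (iter t step phi x)) -addrA.
rewrite (le_trans (ler_normD _ _))//.
apply: (le_trans (lerD (osc t x x0) (hl t))).
have e : B * al ^+ t / (1 - al) = al ^+ t * (B / (1 - al)) by ring.
rewrite e -mulrDr [C * _]mulrC -mulrA ler_pM2l ?exprn_gt0//.
have : 0 <= B / (1 - al) * V x by rewrite mulr_ge0// divr_ge0// ltW.
have : 0 <= b * V x0 * V x by rewrite !mulr_ge0// ltW.
have := V_ge0 x.
by rewrite /C; lra.
Qed.

Let step_cvg (f_ : nat -> T -> R) (f : T -> R) (M : R) : (forall n, measurable_fun setT (f_ n)) ->
  (forall n x, `|f_ n x| <= M) -> (forall x, f_ n x @[n --> \oo] --> f x) ->
  forall x, step (f_ n) x @[n --> \oo] --> step f x.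
Proof.
move=> mf fM ff x; apply: (@bounded_Rintegral_cvg _ _ _ _ _ _ M) => // n.
exact: measurableT_comp (mf n) (mF x).
Qed.

Let iter_cvg (f_ : nat -> T -> R) (f : T -> R) (M : R) t : (forall n, measurable_fun setT (f_ n)) ->
  (forall n x, `|f_ n x| <= M) -> (forall x, f_ n x @[n --> \oo] --> f x) ->
  forall x, iter t step (f_ n) x @[n --> \oo] --> iter t step f x.
Proof.
move=> mf fM ff; have bf n : bm (f_ n) by split=> //; exists M.
elim: t => //= t IH x.
apply: (@step_cvg (fun n => iter t step (f_ n)) _ M) => //.
  by move=> n; have [] := iter_bm t (bf n).
by move=> n; exact: iter_bound.
Qed.

Let iter_add t f g x : bm f -> bm g ->
  iter t step (fun z => f z + g z) x = iter t step f x + iter t step g x.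
Proof.
move=> bf bg; elim: t x => //= t IH x.
by rewrite (funext IH) step_add//; exact: iter_bm.
Qed.

Let iter_scale t a f x : bm f ->
  iter t step (fun z => a * f z) x = a * iter t step f x.
Proof.
move=> bf; elim: t x => //= t IH x.
by rewrite (funext IH) step_scale//; exact: iter_bm.
Qed.

(** The base point is arbitrary: on bounded measurable functions the iterates have this same limit
    from every starting point. *)
Definition ergodic_mean (phi : T -> R) : R := lim (iter t step phi x0 @[t --> \oo]).

Let rate_cvg0 (C g : R) : 0 < g < 1 -> C * g ^+ t @[t --> \oo] --> (0 : R).
Proof.
move=> /andP[g0 g1]; rewrite -[X in _ --> X](mulr0 C).
apply: cvgM; first exact: cvg_cst.
by apply: cvg_expr; rewrite gtr0_norm.
Qed.

Lemma ergodic_rate : exists (gamma C : R), [/\ 0 < gamma < 1, 0 < C &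
  forall phi : T -> R, measurable_fun setT phi -> (forall z, `|phi z| <= 1) ->
  forall t x, `|iter t step phi x - ergodic_mean phi| <= C * gamma ^+ t * (1 + V x)].
Proof.
have [g [C [g01 C0 h]]] := harris_convergence.
exists g, C; split=> // phi mphi phi1; have [l hl] := h phi mphi phi1.
suff -> : ergodic_mean phi = l by [].
apply: cvg_lim => //; apply/subr_cvg0/norm_cvg0P.
apply: (@squeeze_cvgr _ _ _ _ (cst 0) (fun t => (C * (1 + V x0)) * g ^+ t)).
- by apply: nearW => t; rewrite normr_ge0/= (le_trans (hl t x0))// mulrAC.
- exact: cvg_cst.
- exact: rate_cvg0.
Qed.

Let scale_unit (f : T -> R) (M : R) : measurable_fun setT f -> (forall x : T, `|f x| <= M) ->
  let g x := (`|M| + 1)^-1 * f x in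
  [/\ measurable_fun setT g, forall x, `|g x| <= 1 &
      f = fun x => (`|M| + 1) * g x].
Proof.
move=> mf fM g; have m0 : 0 < `|M| + 1 by rewrite ltr_wpDl.
split; first exact: measurable_funM.
  move=> x; rewrite /g normrM gtr0_norm ?invr_gt0// mulrC ler_pdivrMr// mul1r.
  by rewrite (le_trans (fM x))// (le_trans (ler_norm M))// lerDl.
by apply/funext => x; rewrite /g mulrA mulfV ?mul1r// gt_eqF.
Qed.

Lemma ergodic_cvg f x : bm f -> iter t step f x @[t --> \oo] --> ergodic_mean f.
Proof.
have [g [C [g01 C0 h]]] := ergodic_rate.
have unit (f' : T -> R) y : measurable_fun setT f' -> (forall x, `|f' x| <= 1) ->
    iter t step f' y @[t --> \oo] --> ergodic_mean f'.
  move=> mf f1; apply/subr_cvg0/norm_cvg0P.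
  apply: (@squeeze_cvgr _ _ _ _ (cst 0) (fun t => (C * (1 + V y)) * g ^+ t)).
  - by apply: nearW => t; rewrite normr_ge0/= (le_trans (h f' mf f1 t y))// mulrAC.
  - exact: cvg_cst.
  - exact: rate_cvg0.
move=> [mf [M fM]]; have [mf' f1' ->] := scale_unit mf fM.
set f' := fun z => _ * f z in mf' f1' *.
have bf' : bm f' by split=> //; exists 1.
have c y : iter t step (fun z => (`|M| + 1) * f' z) y @[t --> \oo] -->
    (`|M| + 1) * ergodic_mean f'.
  rewrite (_ : (fun t => _) = fun t => (`|M| + 1) * iter t step f' y); last first.
    by apply/funext => t; rewrite iter_scale.
  by apply: cvgM; [exact: cvg_cst|exact: unit].
suff -> : ergodic_mean (fun z => (`|M| + 1) * f' z) = (`|M| + 1) * ergodic_mean f' by [].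
by apply: cvg_lim.
Qed.

(** Bounded convergence is the delicate point, being an exchange of two limits: the rate is uniform
    over functions with a common bound, so one [t] serves all [f_ n], and a fixed iterate passes to
    the limit. *)
Lemma ergodic_functional : bounded_functional ergodic_mean.
Proof.
have sc a f : bm f -> ergodic_mean (fun x => a * f x) = a * ergodic_mean f.
  move=> bf; apply: cvg_lim => //.
  rewrite (_ : (fun t => _) = fun t => a * iter t step f x0); last first.
    by apply/funext => t; rewrite iter_scale.
  by apply: cvgM; [exact: cvg_cst|exact: ergodic_cvg].
have [g [C [g01 C0 h]]] := ergodic_rate.
split=> //.
- move=> f1 f2 b1 b2; apply: cvg_lim => //.
  rewrite (_ : (fun t => _) = fun t => iter t step f1 x0 + iter t step f2 x0); last first.
    by apply/funext => t; rewrite iter_add.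
  by apply: cvgD; exact: ergodic_cvg.
- move=> f_ f M mf fM ff.
  have mf0 : measurable_fun setT f.
    by apply: measurable_fun_cvg => // x _; exact: ff.
  have fM0 x : `|f x| <= M.
    have c : `|f_ n x| @[n --> \oo] --> `|f x| by exact: cvg_norm.
    rewrite -(cvg_lim (@Rhausdorff R) c); apply: limr_le.
      by apply/cvg_ex; exists `|f x|.
    by apply: nearW => n; exact: fM.
  pose m := `|M| + 1; have m0 : 0 < m by rewrite ltr_wpDl.
  have rate (f' : T -> R) t : measurable_fun setT f' -> (forall x, `|f' x| <= M) ->
      `|iter t step f' x0 - ergodic_mean f'| <= m * (C * (1 + V x0)) * g ^+ t.
    move=> mf' fM'; have [mg g1 ->] := scale_unit mf' fM'.
    set f'' := fun z => _ * f' z in mg g1 *.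
    have b'' : bm f'' by split=> //; exists 1.
    rewrite iter_scale// sc// -mulrBr normrM gtr0_norm// -!mulrA ler_pM2l//.
    by rewrite [(1 + _) * _]mulrC mulrA; exact: h.
  apply/cvgrPdist_lt => e e0.
  have e3 : 0 < e / 3 by rewrite divr_gt0.
  have [t ht] : exists t, m * (C * (1 + V x0)) * g ^+ t < e / 3.
    have /cvgrPdist_lt/(_ _ e3)[t _ ht] := rate_cvg0 (m * (C * (1 + V x0))) g01.
    exists t; have := ht t (leqnn t); rewrite sub0r normrN; apply: le_lt_trans.
    exact: ler_norm.
  have ct := @iter_cvg f_ f M t mf fM ff x0.
  near=> n.
  have h1 := rate f t mf0 fM0; have h2 := rate (f_ n) t (mf n) (fM n).
  have h3 : `|iter t step f x0 - iter t step (f_ n) x0| < e / 3.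
    by near: n; exact: cvgr_dist_lt ct _ e3.
  have -> : ergodic_mean f - ergodic_mean (f_ n) =
      (iter t step f x0 - iter t step (f_ n) x0) -
      (iter t step f x0 - ergodic_mean f) +
      (iter t step (f_ n) x0 - ergodic_mean (f_ n)) by ring.
  apply: le_lt_trans (ler_normD _ _) _.
  have := ler_normB (iter t step f x0 - iter t step (f_ n) x0)
    (iter t step f x0 - ergodic_mean f).
  by move: h1 h2 h3 ht; lra.
Unshelve. all: by end_near. Qed.

(** A measure must be nonnegative on every set, while the mean of an indicator is controlled only
    for measurable ones; hence the default 0. *)
Definition invariant_law (B : set T) : \bar R :=
  if pselect (measurable B) then (ergodic_mean \1_B)%:E else 0%E.

Let invariant_lawE B : measurable B -> invariant_law B = (ergodic_mean \1_B)%:E.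
Proof. by rewrite /invariant_law; case: pselect. Qed.

Let mean_indic_ge0 B : measurable B -> 0 <= ergodic_mean \1_B.
Proof.
move=> mB; have c := ergodic_cvg x0 (bm_indic mB).
rewrite -(cvg_lim (@Rhausdorff R) c); apply: limr_ge.
  by apply/cvg_ex; exists (ergodic_mean \1_B).
apply: nearW => t; elim: t x0 {c} => [|t IH] x /=; first by rewrite indicE.
by apply: Rintegral_ge0.
Qed.

Let invariant_law0 : invariant_law set0 = 0%E.
Proof.
rewrite invariant_lawE// (_ : \1_set0 = fun x : T => 0 * cst 0 x :> R); last first.
  by apply/funext => x; rewrite indicE in_set0 mul0r.
by rewrite (bf_scale ergodic_functional _ (bm_cst 0)) mul0r.
Qed.

Let invariant_law_ge0 B : (0 <= invariant_law B)%E.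
Proof.
rewrite /invariant_law; case: pselect => // mB.
by rewrite lee_fin mean_indic_ge0.
Qed.

Let invariant_law_sigma_additive : semi_sigma_additive invariant_law.
Proof.
move=> A mA tA mUA.
have fin n : (\sum_(0 <= i < n) invariant_law (A i))%E =
    (ergodic_mean \1_(\big[setU/set0]_(i < n) A i))%:E.
  elim: n => [|n IH]; first by rewrite big_nil big_ord0 -invariant_lawE// invariant_law0.
  rewrite big_nat_recr//= IH invariant_lawE// -EFinD; congr (_%:E).
  have mb : measurable (\big[setU/set0]_(i < n) A i).
    by apply: bigsetU_measurable => i _.
  rewrite -(bf_add ergodic_functional (bm_indic mb) (bm_indic (mA n))).
  congr ergodic_mean; apply/funext => x; rewrite big_ord_recr/= !indicE in_setU.
  have [xb|xb] := boolP (x \in \big[setU/set0]_(i < n) A i); last first.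
    by rewrite add0r.
  suff /negbTE -> : x \notin A n by rewrite addr0.
  apply/negP; rewrite inE => xn; move: xb; rewrite inE -bigcup_mkord => -[k /= kn xk].
  have := (trivIsetP.1 tA) k n Logic.I Logic.I; rewrite ltn_eqF// => /(_ isT).
  by move=> /seteqP[/(_ x (conj xk xn))].
rewrite invariant_lawE//.
rewrite (_ : (fun n => _) =
  fun n => (ergodic_mean \1_(\big[setU/set0]_(i < n) A i))%:E); last exact/funext.
apply: cvg_EFin; first exact: nearW.
apply: (@bf_cvg _ _ _ _ ergodic_functional
  (fun n => \1_(\big[setU/set0]_(i < n) A i)) _ 1).
- by move=> n; apply: measurable_indic; apply: bigsetU_measurable.
- by move=> n x; rewrite indicE; case: (_ \in _); rewrite ?normr0 ?normr1.
- move=> x; apply: cvg_near_cst.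
  have [[k _ Ak]|nA] := pselect ((\bigcup_k A k) x).
    near=> n; have h1 : (\bigcup_k A k) x by exists k.
    have h2 : (\big[setU/set0]_(k < n) A k) x.
      rewrite -bigcup_mkord; exists k => //=.
      by near: n; exact: nbhs_infty_gt.
    by rewrite !indicE !mem_set.
  apply: nearW => n; have h : ~ (\big[setU/set0]_(k < n) A k) x.
    by rewrite -bigcup_mkord => -[k _ Ak]; apply: nA; exists k.
  by rewrite !indicE !memNset.
Unshelve. all: by end_near. Qed.

HB.instance Definition _ := isMeasure.Build _ _ _ invariant_law
  invariant_law0 invariant_law_ge0 invariant_law_sigma_additive.

Let invariant_lawT : invariant_law setT = 1%E.
Proof.
rewrite invariant_lawE//; congr (_%:E); apply: cvg_lim => //.
apply: cvg_near_cst; apply: nearW => t; elim: t x0 => [|t IH] x /=.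
  by rewrite indicE in_setT.
by rewrite (funext IH) step_cst.
Qed.

HB.instance Definition _ := Measure_isProbability.Build _ _ _ invariant_law invariant_lawT.

Theorem harris : exists pi : probability T R,
  (forall B, measurable B -> pi B = (\int[pi]_x P (F x @^-1` B))%E) /\
  (forall pi' : probability T R,
    (forall B, measurable B -> pi' B = (\int[pi']_x P (F x @^-1` B))%E) ->
    forall B, measurable B -> pi' B = pi B) /\
  exists gamma C : R, 0 < gamma < 1 /\ 0 < C /\
    forall t x (phi : T -> R), measurable_fun setT phi -> (forall z, `|phi z| <= 1) ->
      `|iter t step phi x - \int[pi]_x phi x| <= C * gamma ^+ t * (1 + V x).
Proof.
pose pi : probability T R := invariant_law.
have piE B : measurable B -> pi B = (ergodic_mean \1_B)%:E by exact: invariant_lawE.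
have piI f : bm f -> \int[pi]_x f x = ergodic_mean f.
  apply: (bounded_functional_ext (bf_Rintegral pi) ergodic_functional) => B mB.
  rewrite (@Rintegral_indic_comp _ _ _ _ pi id B mB) preimage_id.
  exact: (congr1 fine (piE B mB)).
have kerE (m : probability T R) B : measurable B ->
    (\int[m]_x P (F x @^-1` B))%E = (\int[m]_x step \1_B x)%:E.
  move=> mB; have mFB x : measurable (F x @^-1` B).
    by rewrite -[X in measurable X]setTI; exact: mF.
  have [ms [M sM]] := step_bm (bm_indic mB).
  rewrite fineK; last exact: integrable_fin_num (bounded_integrable m ms sM).
  apply: eq_integral => x _.
  by rewrite /step Rintegral_indic_comp// fineK// fin_num_measure.
have indE (m : probability T R) B : measurable B -> m B = (\int[m]_x \1_B x)%:E.
  by move=> mB; rewrite (@Rintegral_indic_comp _ _ _ _ m id B mB) preimage_id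
    fineK// fin_num_measure.
exists pi; split=> [B mB|].
  (* Invariance is a shift of the time index: the iterates of [step \1_B] are those of [\1_B] one
     step later. *)
  rewrite kerE// piI; last exact: step_bm (bm_indic mB).
  apply: etrans (piE B mB) _; congr (_%:E).
  apply/esym/cvg_lim => //.
  rewrite (_ : (fun t => iter t step (step \1_B) x0) =
    (fun t => iter t.+1 step \1_B x0)); last first.
    by apply/funext => n; rewrite iterSr.
  by have := ergodic_cvg x0 (bm_indic mB); rewrite -cvg_shiftS.
split=> [pi' inv' B mB|].
  (* Invariance is given on indicators only; both sides are bounded functionals, so it extends to
     the iterates of [\1_B]. *)
  have inv f : bm f -> \int[pi']_x step f x = \int[pi']_x f x.
    apply: (@bounded_functional_ext _ _ _ (fun f => \int[pi']_x step f x)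
      (fun f => \int[pi']_x f x)); last 2 first.
    - exact: bf_Rintegral.
    - by move=> A mA; apply: EFin_inj; rewrite -kerE// -indE// -inv'.
    split.
    - move=> f1 f2 b1 b2; rewrite -(bf_add (bf_Rintegral pi'))//.
      + by apply: eq_Rintegral => x _; exact: step_add.
      + exact: step_bm.
      + exact: step_bm.
    - move=> a f1 b1; rewrite -(bf_scale (bf_Rintegral pi') _ (step_bm b1)).
      by apply: eq_Rintegral => x _; exact: step_scale.
    - move=> f_ f1 M mf fM ff.
      apply: (bf_cvg (bf_Rintegral pi') (f_ := fun n => step (f_ n)) (M := M)).
      + by move=> n; have [] := @step_bm (f_ n) (conj (mf n) (ex_intro _ M (fM n))).
      + by move=> n x; exact: step_bound.
      + exact: step_cvg mf fM ff.
  have invt t : \int[pi']_x iter t step \1_B x = \int[pi']_x \1_B x.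
    by elim: t => //= t IH; rewrite inv//; exact: iter_bm t _ (bm_indic mB).
  have bB : bm (\1_B) := bm_indic mB.
  have i1 z : `|(\1_B z : R)| <= 1.
    by rewrite indicE; case: (_ \in _); rewrite ?normr0 ?normr1.
  (* Nothing says that [V] is integrable under [pi'], so pointwise bounded convergence is used
     instead of the rate. *)
  have c : \int[pi']_x iter t step \1_B x @[t --> \oo] --> \int[pi']_x ergodic_mean \1_B.
    apply: (@bounded_Rintegral_cvg _ _ _ _ _ _ 1).
    - by move=> n; have [] := iter_bm n bB.
    - by move=> n x; exact: iter_bound.
    - by move=> x; exact: ergodic_cvg.
  rewrite (indE pi' B mB); apply: etrans (esym (piE B mB)); congr (_%:E).
  have e : (fun t => \int[pi']_x iter t step \1_B x) = fun=> \int[pi']_x \1_B x.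
    by apply/funext => t; exact: invt.
  rewrite e Rintegral_prob_cst in c.
  rewrite -(cvg_lim (@Rhausdorff R) c); apply/esym.
  by apply: cvg_lim => //; exact: cvg_cst.
have [g [C [g01 C0 h]]] := ergodic_rate.
exists g, C; split=> //; split=> // t x phi mphi phi1.
by rewrite piI; [exact: h|split=> //; exists 1].
Qed.

End Harris.

(** * The autoregressive chain *)

Lemma L2_inner_product {R : realType} (d : nat)
  (lam : {measure set (d.-tuple R) -> \bar R}) (H : normedModType R)
  (U : H -> d.-tuple R -> R) : L2_model lam U -> inner_product (L2_inner lam U).
Proof.
move=> [UL Ulin _ _ Unorm].
have iU x y : lam.-integrable setT (EFin \o (fun u => U x u * U y u)).
  by apply/Lfun1_integrable; exact: Lfun2_mul_Lfun1.
have comb a x y z : L2_inner lam U (a *: x + y) z =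
    a * L2_inner lam U x z + L2_inner lam U y z.
  rewrite /L2_inner -RintegralZl// -RintegralD//; last first.
    by have := integrableZl measurableT a (iU x z); apply: eq_integrable.
  congr fine; apply: ae_eq_integral => //.
  - exact: measurable_int (iU _ z).
  - have := measurable_int lam (iU x z); have := measurable_int lam (iU y z).
    move=> /measurable_EFinP m1 /measurable_EFinP m2; apply/measurable_EFinP.
    by apply: measurable_funD => //; exact: measurable_funM.
  - apply: filterS (Ulin a x y) => u h uT; rewrite h//; congr (_%:E); ring.
(* Since [U] is linear only almost everywhere, this is drawn from [comb] with coefficient -1 and two
   zero vectors. *)
have zl z : L2_inner lam U 0 z = 0.
  have := comb (- 1) 0 0 z; rewrite scaler0 addr0 => ->.
  by rewrite mulN1r addNr.
split.
- by move=> x y; apply: eq_Rintegral => u _; rewrite mulrC.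
- by move=> x y z; have := comb 1 x y z; rewrite scale1r mul1r.
- by move=> a x y; have := comb a x 0 y; rewrite addr0 zl addr0.
- by move=> x; rewrite Unorm; apply: eq_Rintegral => u _; rewrite expr2.
Qed.

(** * Trace and norm of the covariance operator *)

Section Covariance.
Context {R : realType} {H : normedModType R}.
Variable ip : H -> H -> R.
Hypothesis ipP : inner_product ip.
Context {dO : measure_display} {Omega : measurableType dO}.
Variable P : probability Omega R.
Variable xi : Omega -> BorelT H.
Hypothesis mxi : measurable_fun setT xi.
Hypothesis xi2 : (\int[P]_w (`|xi w : H| ^+ 2)%:E < +oo)%E.
Variable Q : {linear H -> H}.
Hypothesis cov : forall f g,
  ip (Q f) g = \int[P]_w (ip f (xi w) * ip g (xi w)).

Let mnorm : measurable_fun setT (fun w => `|xi w : H|).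
Proof.
apply: (@measurableT_comp _ _ _ _ _ _ (fun y : BorelT H => `|y : H|)) => //.
by apply: borel_continuous_measurable => x; exact: norm_continuous.
Qed.

Let mip g : measurable_fun setT (fun w => ip g (xi w)).
Proof.
apply: (@measurableT_comp _ _ _ _ _ _ (ip g : BorelT H -> R)) => //.
by apply: borel_continuous_measurable; exact: ip_continuous.
Qed.

Definition trace_bound : R := \int[P]_w (`|xi w : H| ^+ 2).

Lemma xi_sqr_integrable : P.-integrable setT (EFin \o (fun w => `|xi w : H| ^+ 2)).
Proof.
apply/integrableP; split; first by apply/measurable_EFinP; exact: measurable_funX.
by under eq_integral do rewrite /= ger0_norm ?sqr_ge0//.
Qed.

Lemma xi_norm_integrable : P.-integrable setT (EFin \o (fun w => `|xi w : H|)).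
Proof.
have i1 : P.-integrable setT (EFin \o (fun _ : Omega => 1 : R)).
  by apply: (@bounded_integrable _ _ _ P _ 1) => // w; rewrite normr1.
apply: le_integrable (integrableD measurableT i1 xi_sqr_integrable) => //.
  exact/measurable_EFinP.
move=> w _ /=; rewrite lee_fin normr_id ger0_norm ?addr_ge0 ?sqr_ge0//.
by have := sqr_ge0 (`|xi w : H| - 1); have := normr_ge0 (xi w : H); nra.
Qed.

Lemma ip_prod_integrable f g :
  P.-integrable setT (EFin \o (fun w => ip f (xi w) * ip g (xi w))).
Proof.
have := integrableZl measurableT (`|f| * `|g|) xi_sqr_integrable.
apply: le_integrable => //; first exact/measurable_EFinP/measurable_funM.
move=> w _ /=; rewrite lee_fin normrM [leRHS]ger0_norm ?mulr_ge0 ?sqr_ge0//.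
have -> : `|f| * `|g| * `|xi w : H| ^+ 2 = (`|f| * `|xi w : H|) * (`|g| * `|xi w : H|).
  by ring.
by apply: ler_pM => //; exact: cauchy_schwarz.
Qed.

Lemma trace_bound_ge0 : 0 <= trace_bound.
Proof. by apply: Rintegral_ge0 => w _; exact: sqr_ge0. Qed.

Lemma cov_sym f g : ip (Q f) g = ip (Q g) f.
Proof. by rewrite !cov; apply: eq_Rintegral => w _; rewrite mulrC. Qed.

Lemma cov_ge0 f : 0 <= ip (Q f) f.
Proof. by rewrite cov; apply: Rintegral_ge0 => w _; rewrite -expr2 sqr_ge0. Qed.

(** Bessel's inequality for each [xi w], averaged over [w]. *)
Lemma cov_trace (s : seq H) : orthonormal ip s ->
  \sum_(i < size s) ip (Q s`_i) s`_i <= trace_bound.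
Proof.
move=> os.
have [i e] : P.-integrable setT (EFin \o (fun w => \sum_(i < size s) ip s`_i (xi w) ^+ 2))
    /\ \int[P]_w (\sum_(i < size s) ip s`_i (xi w) ^+ 2) =
       \sum_(i < size s) ip (Q s`_i) s`_i.
  elim: (size s) => [|n [IH1 IH2]].
    rewrite (_ : (fun w => _) = fun=> 0); last first.
      by apply/funext => w; rewrite big_ord0.
    rewrite big_ord0 Rintegral_prob_cst; split=> //.
    by apply: (@bounded_integrable _ _ _ P _ 0) => // w; rewrite normr0.
  rewrite (_ : (fun w => _) = fun w => \sum_(i < n) ip s`_i (xi w) ^+ 2 +
      ip s`_n (xi w) * ip s`_n (xi w)); last first.
    by apply/funext => w; rewrite big_ord_recr.
  have j := ip_prod_integrable s`_n s`_n; split.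
    by have := integrableD measurableT IH1 j; apply: eq_integrable.
  by rewrite big_ord_recr/= RintegralD// IH2 cov.
rewrite -e; apply: le_Rintegral => //; first exact: xi_sqr_integrable.
by move=> w _; exact: bessel.
Qed.

(** Write [|Q x|^2] as the mean of [<x, xi> <Q x, xi>] and apply Cauchy-Schwarz. A finite bound is
    needed before [op_norm], a supremum of reals, can be trusted as an upper bound. *)
Let Q_bounded x : `|Q x| <= trace_bound * `|x|.
Proof.
have [->|Qx0] := eqVneq (Q x) 0; first by rewrite normr0 mulr_ge0// trace_bound_ge0.
rewrite -(@ler_pM2r _ `|Q x|) ?normr_gt0// -expr2 -(ipxx ipP) cov.
have -> : trace_bound * `|x| * `|Q x| =
    \int[P]_w (`|x| * `|Q x| * `|xi w : H| ^+ 2).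
  by rewrite RintegralZl//; [rewrite -/trace_bound; ring|exact: xi_sqr_integrable].
apply: le_Rintegral => //; first exact: ip_prod_integrable.
  have := integrableZl measurableT (`|x| * `|Q x|) xi_sqr_integrable.
  by apply: eq_integrable.
move=> w _; apply: (le_trans (ler_norm _)); rewrite normrM.
have -> : `|x| * `|Q x| * `|xi w : H| ^+ 2 = (`|x| * `|xi w : H|) * (`|Q x| * `|xi w : H|).
  by ring.
by apply: ler_pM => //; exact: cauchy_schwarz.
Qed.

Let has_sup_op_norm : has_sup [set `|Q x| | x in [set x : H | `|x| <= 1]].
Proof.
split; first by exists `|Q 0|, 0 => //=; rewrite normr0.
exists trace_bound => _ [x /= x1 <-]; rewrite (le_trans (Q_bounded x))//.
by rewrite ler_piMr// trace_bound_ge0.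
Qed.

Lemma op_norm_ge0 : 0 <= op_norm Q.
Proof.
apply: (@le_trans _ _ `|Q 0|) => //; apply: sup_upper_bound => //.
by exists 0 => //=; rewrite normr0.
Qed.

Lemma op_norm_le x : `|Q x| <= op_norm Q * `|x|.
Proof.
have [->|x0] := eqVneq x 0; first by rewrite linear0 !normr0 mulr0.
have nx : 0 < `|x| by rewrite normr_gt0.
rewrite -ler_pdivrMr// mulrC -[`|x|^-1]ger0_norm ?invr_ge0// -normrZ -linearZ.
apply: sup_upper_bound => //; exists (`|x|^-1 *: x) => //=.
by rewrite normrZ ger0_norm ?invr_ge0// mulVf// gt_eqF.
Qed.

Lemma cov_le h : ip (Q h) h <= op_norm Q * `|h| ^+ 2.
Proof.
apply: (le_trans (ler_norm _)); apply: (le_trans (cauchy_schwarz ipP _ _)).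
by rewrite expr2 mulrA ler_wpM2r// op_norm_le.
Qed.

End Covariance.

Lemma borel_mapE {R : realType} {H : normedModType R} (f : H -> H) :
  borel_map f -> measurable_fun setT (f : BorelT H -> BorelT H).
Proof. by move=> mf _ B mB; rewrite setTI; exact: mf. Qed.

Unset Implicit Arguments.
Set Strict Implicit.

Theorem theorem3p1
  (R : realType) (d : nat) (hd : (0 < d)%N)
  (lam : {measure set (d.-tuple R) -> \bar R})
  (hlam : lebesgue_on_unit_cube lam)
  (H : normedModType R) (U : H -> d.-tuple R -> R)
  (hU : L2_model lam U)
  (dO : measure_display) (Omega : measurableType dO)
  (P : probability Omega R)
  (F : nat -> set (set Omega)) (hF : is_filtration F)
  (Psi0 : H -> H) (hPsi0 : borel_map Psi0)
  (X xi : nat -> Omega -> H)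
  (hX : forall t, meas_wrt (F t) (X t))
  (hxiF : forall t, meas_wrt (F t.+1) (xi t))
  (hxiind : forall t, indep_of P (F t) (xi t))
  (hmodel : forall t w, X t.+1 w = Psi0 (X t w) + xi t w)
  (Q : {linear H -> H})
  (hxi2 : (\int[P]_w (`|xi 1%N w| ^+ 2)%:E < +oo)%E)
  (hQ : forall f g : H,
     L2_inner lam U (Q f) g
     = Rintegral P setT (fun w => L2_inner lam U f (xi 1%N w) * L2_inner lam U g (xi 1%N w)))
  (* (G) *)
  (hG : forall t, gaussian0 P (L2_inner lam U) Q (xi t))
  (* (Q) : the closure of Im(Q) is H *)
  (hQdense : forall (x : H) (e : R), 0 < e -> exists y : H, `|Q y - x| < e)
  (* (M1) *)
  (m0 : H -> H) (hm0 : borel_map m0) (hM1 : forall x, Psi0 x = Q (m0 x))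
  (* (M2) *)
  (c1 c2 : R) (hc1 : 0 < c1) (hc2 : 0 < c2) (hc1Q : c1 * op_norm Q < 1)
  (hM2 : forall x, `|m0 x| <= c1 * `|x| + c2) :
  exists pi : probability (BorelT H) R,
    invariant_prob P Psi0 (xi 1%N) pi /\
    (forall pi' : probability (BorelT H) R,
        invariant_prob P Psi0 (xi 1%N) pi' ->
        forall B : set (BorelT H), measurable B -> pi' B = pi B) /\
    exists gamma C : R, 0 < gamma < 1 /\ 0 < C /\
      forall (t : nat) (x : H) (phi : BorelT H -> R),
        measurable_fun setT phi -> (forall z, `|phi z| <= 1) ->
        `|trans_op P Psi0 (xi 1%N) t phi x - Rintegral pi setT phi|
          <= C * gamma ^+ t * (1 + `|x|).
Proof.
have ipP := L2_inner_product hU; set ip := L2_inner lam U in ipP hQ hG.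
pose xi1 : Omega -> BorelT H := xi 1%N.
have mxi : measurable_fun setT xi1.
  move=> _ B mB; rewrite setTI; have [_ Fm _] := hF 2%N.
  by apply: Fm; exact: hxiF.
have Qsym := cov_sym hQ; have Qge0 := cov_ge0 hQ.
have Qtr := cov_trace ipP mxi hxi2 hQ.
have hborel := borel_sub_halfspaces ipP Qsym Qge0 Qtr hQdense.
have N0 := op_norm_ge0 ipP mxi hxi2 hQ.
have QN := op_norm_le ipP mxi hxi2 hQ.
have covN := cov_le ipP mxi hxi2 hQ.
have ixi := xi_norm_integrable mxi hxi2.
set N := op_norm Q in N0 QN covN hc1Q.
pose kappa := @gauss_abs_moment R; have kappa0 : 0 <= kappa := gauss_abs_moment_ge0.
pose G (phi : BorelT H -> R) (h : H) := \int[P]_w phi (Q h + xi1 w).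
have shift (phi : BorelT H -> R) h k : measurable_fun setT phi ->
    (forall z, `|phi z| <= 1) ->
    `|G phi (k + h) - G phi h| <= 2 * (1 - expR (- (kappa * (Num.sqrt N * `|k|) + N * `|k| ^+ 2 / 2))).
  (* Absorbing [Q h] into the test function leaves a translation by [Q k] alone, so the bound
     depends on the difference [k] only. *)
  move=> mphi phi1; pose phi' (y : BorelT H) := phi (Q h + y : H).
  have mphi' : measurable_fun setT phi'.
    apply: (measurableT_comp mphi); apply: borel_continuous_map => y.
    by apply: cvgD; [exact: cvg_cst|exact: cvg_id].
  have := gaussian_translation ipP hborel mxi Qsym Qge0 (hG 1%N) k mphi' (fun y => phi1 _).
  have -> : \int[P]_w phi' (Q k + xi1 w) = G phi (k + h).
    by apply: eq_Rintegral => w _; rewrite /phi' linearD addrA [Q h + _]addrC.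
  move=> /le_trans; apply; rewrite ler_pM2l// lerD2l lerN2 ler_expR lerN2.
  apply: lerD; last by rewrite ler_pM2r// covN.
  rewrite -/kappa ler_wpM2l// -[`|k|]ger0_norm// -sqrtr_sqr -sqrtrM//.
  by rewrite ler_wsqrtr// covN.
have contG (phi : BorelT H -> R) : measurable_fun setT phi ->
    (forall z, `|phi z| <= 1) -> continuous (G phi).
  move=> mphi phi1 h; apply/cvgrPdist_le => e e0.
  (* From [1 - exp (- u) <= u] and [k^2 <= k] for [0 <= k <= 1], the bound of [shift] is at most
     [c k]; the added 1 makes [c] positive. *)
  pose c := 2 * (kappa * Num.sqrt N) + N + 1.
  have c0 : 0 < c by rewrite ltr_wpDl// addr_ge0// !mulr_ge0// sqrtr_ge0.
  near=> h'.
  have small1 : `|h - h'| <= 1.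
    by near: h'; apply: cvgr_dist_le; [exact: cvg_id|].
  have small2 : `|h - h'| <= e / c.
    by near: h'; apply: cvgr_dist_le; [exact: cvg_id|rewrite divr_gt0].
  rewrite -[h in G phi h](subrK h') (le_trans (shift phi h' (h - h') mphi phi1))//.
  set k := `|h - h'| in small1 small2 *.
  set u := kappa * _ + _; have := expR_ge1Dx (- u) => hu.
  have k0 : 0 <= k by rewrite normr_ge0.
  have kk : N * k ^+ 2 <= N * k by rewrite ler_wpM2l// expr2 ler_piMr.
  have ce : c * k <= e by rewrite mulrC -ler_pdivlMr.
  by move: ce hu kk; rewrite /c /u; lra.
pose F1 (x : BorelT H) (w : Omega) : BorelT H := (Psi0 x : H) + (xi1 w : H).
have mF1 x : measurable_fun setT (F1 x).
  apply: (measurableT_comp (f := fun y : BorelT H => (Psi0 x + y : H) : BorelT H)) => //.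
  apply: borel_continuous_map => y.
  by apply: cvgD; [exact: cvg_cst|exact: cvg_id].
have stepE (phi : BorelT H -> R) : step P F1 phi = fun x => G phi (m0 x).
  by apply/funext => x; rewrite /step /F1 /G hM1.
have mstep1 (phi : BorelT H -> R) : measurable_fun setT phi ->
    (forall z, `|phi z| <= 1) -> measurable_fun setT (step P F1 phi).
  move=> mphi phi1; rewrite stepE.
  apply: (measurableT_comp (f := (G phi : BorelT H -> R))).
    by apply: borel_continuous_measurable; exact: contG.
  exact: borel_mapE.
pose V (x : BorelT H) : R := `|x : H|.
have V0 x : 0 <= V x by rewrite /V.
have mV : measurable_fun setT V.
  by apply: borel_continuous_measurable => x; exact: norm_continuous.
have icst c : P.-integrable setT (EFin \o (fun _ : Omega => c : R)).
  by apply: (@bounded_integrable _ _ _ P _ `|c|).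
have Vle x w : V (F1 x w) <= N * (c1 * `|x| + c2) + `|xi1 w : H|.
  rewrite /V /F1 (le_trans (ler_normD _ _))// lerD2r hM1 (le_trans (QN _))//.
  by rewrite ler_wpM2l.
have ibd x : P.-integrable setT (EFin \o (fun w => N * (c1 * `|x : H| + c2) + `|xi1 w : H|)).
  by have := integrableD measurableT (icst (N * (c1 * `|x : H| + c2))) ixi; apply: eq_integrable.
have iV x : P.-integrable setT (EFin \o (fun w => V (F1 x w))).
  apply: (le_integrable measurableT _ _ (ibd x)).
    by apply/measurable_EFinP; exact: (measurableT_comp mV).
  move=> w _; rewrite /= lee_fin ger0_norm// (le_trans (Vle x w))//.
  exact: ler_norm.
(* The triangle inequality gives the drift with rate [c1 N]; the added 1 makes the constant strictly
   positive. *)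
pose K0 := N * c2 + \int[P]_w `|xi1 w : H| + 1.
have K00 : 0 < K0.
  rewrite /K0 ltr_wpDl// addr_ge0// ?mulr_ge0 ?(ltW hc2)//.
  by apply: Rintegral_ge0 => w _.
have drift x : \int[P]_w V (F1 x w) <= c1 * N * V x + K0.
  apply: (le_trans (le_Rintegral measurableT (iV x) (ibd x) (fun w _ => Vle x w))).
  by rewrite RintegralD// Rintegral_prob_cst /K0 /V; lra.
have rho01 : 0 <= c1 * N < 1 by rewrite mulr_ge0// ltW.
have overlap r : exists2 delta, 0 < delta <= 1 &
    forall x y (phi : BorelT H -> R), measurable_fun setT phi ->
    (forall z, `|phi z| <= 1) -> V x + V y <= r ->
    `|step P F1 phi x - step P F1 phi y| <= 2 * (1 - delta).
  (* Linear growth of [m0] bounds [|m0 x - m0 y|] by [c1 r + 2 c2] when [V x + V y <= r]; the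
     absolute value keeps [L] nonnegative for every real [r]. *)
  pose L := `|c1 * r + 2 * c2|.
  exists (expR (- (kappa * (Num.sqrt N * L) + N * L ^+ 2 / 2))).
    rewrite expR_gt0/= -[leRHS]expR0 ler_expR oppr_le0.
    have h1 : 0 <= kappa * (Num.sqrt N * L).
      by apply: mulr_ge0 => //; apply: mulr_ge0; [exact: sqrtr_ge0|exact: normr_ge0].
    have h2 : 0 <= N * L ^+ 2 by apply: mulr_ge0 => //; exact: sqr_ge0.
    by apply: addr_ge0 => //; rewrite divr_ge0.
  move=> x y phi mphi phi1 xyr; rewrite stepE.
  rewrite -[m0 x](subrK (m0 y)) (le_trans (shift phi (m0 y) (m0 x - m0 y) mphi phi1))//.
  have kL : `|m0 x - m0 y| <= L.
    rewrite (le_trans (ler_normB _ _))// (le_trans (lerD (hM2 x) (hM2 y)))//.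
    apply: (@le_trans _ _ (c1 * r + 2 * c2)); last exact: ler_norm.
    have : c1 * (V x + V y) <= c1 * r by rewrite ler_pM2l.
    by rewrite /V; lra.
  rewrite ler_pM2l// lerD2l lerN2 ler_expR lerN2 lerD//.
    by rewrite ler_wpM2l// ler_wpM2l// sqrtr_ge0.
  rewrite ler_pM2r// ler_wpM2l//; apply: lerXn2r => //; rewrite nnegrE.
    exact: normr_ge0.
  exact: normr_ge0.
have [pi [pi_inv [pi_uniq [g [C [g01 [C0 rate]]]]]]] :=
  harris mF1 mstep1 V0 rho01 K00 iV drift overlap.
exists pi; split; first by move=> B mB; exact: pi_inv.
split; first by move=> pi' inv' B mB; apply: pi_uniq => // A mA; exact: inv'.
exists g, C; split=> //; split=> //; exact: rate.
Unshelve. all: by end_near. Qed.
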